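(* With the notation of the context, Algorithm G (the alternating direction discrete gradient flow) is well-posed and energy decreasing. Specifically, for all $i\in\mathbb N_0$ the following assertions hold: (i) For all $\ell\in\mathbb N_0$, the variational problem (G1) admits a unique solution $\boldsymbol t_h^{i,\ell}\in\boldsymbol{\mathcal K}_h[\boldsymbol n_h^{i,\ell}]$. (ii) The inner loop terminates in a finite number of iterations, i.e., there exists $\ell\in\mathbb N_0$ such that the stopping criterion (G2) is met. (iii) The variational problem (G3) admits a unique solution $s_h^{i+1}\in V_h$ such that $s_h^{i+1}(z)=g_h(z)$ for all $z\in\mathcal N_h\cap\Gamma_D$. (iv) There holds $$E^h[s_h^{i+1},\boldsymbol n_h^{i+1}]-E^h[s_h^i,\boldsymbol n_h^i]\le-\Big(\tau_s\|d_ts_h^{i+1}\|_{L^2(\Omega)}^2+\tau_{\boldsymbol n}\sum_{\ell=0}^{\ell_i}\|\boldsymbol t_h^{i,\ell}\|_*^2\Big)-\Big(\tau_s^2E_1^h[d_ts_h^{i+1},\boldsymbol n_h^{i+1}]+\tau_{\boldsymbol n}^2\sum_{\ell=0}^{\ell_i}E_1^h[s_h^i,\boldsymbol t_h^{i,\ell}]\Big).$$ In particular, $E^h[s_h^{i+1},\boldsymbol n_h^{i+1}]\le E^h[s_h^i,\boldsymbol n_h^i]$, and equality holds if and only if $(s_h^{i+1},\boldsymbol n_h^{i+1})=(s_h^i,\boldsymbol n_h^i)$ (equilibrium state).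
   Context: Setting. $d\in\{2,3\}$; $\Omega\subset\mathbb R^d$ is a bounded Lipschitz polytopal domain; $\kappa>0$ is a constant; $\Gamma_D\subseteq\partial\Omega$ is relatively open with $|\Gamma_D|>0$. $\mathcal T_h$ is a simplicial mesh of $\Omega$ from a shape-regular family, $h=\max_{K\in\mathcal T_h}\operatorname{diam}(K)$, $\mathcal N_h$ is its set of vertices; $V_h$ is the space of continuous functions on $\overline\Omega$ that are affine on each element, $\mathbf V_h=(V_h)^d$, $I_h$ is the nodal interpolant. $V_{h,D}=\{v_h\in V_h: v_h(z)=0\ \forall z\in\mathcal N_h\cap\Gamma_D\}$, $\mathbf V_{h,D}=(V_{h,D})^d$. For $\boldsymbol n_h\in\mathbf V_h$, $\boldsymbol{\mathcal K}_h[\boldsymbol n_h]=\{\boldsymbol\phi_h\in\mathbf V_{h,D}:\boldsymbol n_h(z)\cdot\boldsymbol\phi_h(z)=0\ \forall z\in\mathcal N_h\}$. $\langle\cdot,\cdot\rangle$ is the $L^2(\Omega)$ inner product of scalar-, vector- or matrix-valued functions; $(\boldsymbol a\otimes\boldsymbol b)_{ij}=a_ib_j$; $|\cdot|$ is the Euclidean/Frobenius norm; $\mathbb N_0=\{0,1,2,\dots\}$. Boundary data: $(g,\boldsymbol q,\boldsymbol r)\in W^{1,\infty}(\mathbb R^d)\times L^\infty(\mathbb R^d;\mathbb R^d)\times W^{1,\infty}(\mathbb R^d;\mathbb R^d)$ with $-1/(d-1)<g<1$, $|\boldsymbol q|=1$, $\boldsymbol r=g\boldsymbol q$ a.e.,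 and $g\ge\delta_0$ on $\Gamma_D$ for some sufficiently small $\delta_0>0$; $g_h=I_h[g]$, $\boldsymbol r_h=I_h[\boldsymbol r]$. Potential: the double well potential $\psi:(-1/(d-1),1)\to\mathbb R_{\ge0}$ satisfies $\psi\in C^2(-1/(d-1),1)$; $\lim_{s\to1^-}\psi(s)=+\infty=\lim_{s\to(-1/(d-1))^+}\psi(s)$; $\psi(0)>\psi(s^* )=\min_{s\in(-1/(d-1),1)}\psi(s)=0$ for some $s^*\in(0,1)$; $\psi'(0)=0$. For the algorithm a convex splitting $\psi=\psi_c-\psi_e$ is assumed, where $\psi_c$ and $\psi_e$ are both convex and $\psi_c$ is quadratic. Discrete energies, for $s_h\in V_h$ and $\boldsymbol n_h\in\mathbf V_h$: $E_1^h[s_h,\boldsymbol n_h]=\frac12\int_\Omega(\kappa|\boldsymbol n_h\otimes\nabla s_h|^2+s_h^2|\nabla\boldsymbol n_h|^2)$, $E_2^h[s_h]=\int_\Omega\psi(s_h)$, $E^h[s_h,\boldsymbol n_h]=E_1^h[s_h,\boldsymbol n_h]+E_2^h[s_h]$. Metric: $\langle\cdot,\cdot\rangle_*$, with induced norm $\|\cdot\|_*$, is either the $L^2$-metric $\langle\boldsymbol\phi,\boldsymbol\psi\rangle_*=\langle\boldsymbol\phi,\boldsymbol\psi\rangle$ or the weighted $H^1$-metric $\langle\boldsymbol\phi,\boldsymbol\psi\rangle_*=\langle h^\alpha\nabla\boldsymbol\phi,\nabla\boldsymbol\psi\rangle$ with $0<\alpha\le2$. Algorithm G. Parameters: time-step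 sizes $\tau_{\boldsymbol n},\tau_s>0$, tolerance $\mathsf{tol}>0$. Notation: $d_ts_h^{i+1}=(s_h^{i+1}-s_h^i)/\tau_s$. Input: $s_h^0\in V_h$, $\boldsymbol n_h^0\in\mathbf V_h$ with $|\boldsymbol n_h^0(z)|=1$ for all $z\in\mathcal N_h$, and $\boldsymbol n_h^0(z)=\boldsymbol r_h(z)/g_h(z)$, $s_h^0(z)=g_h(z)$ for all $z\in\mathcal N_h\cap\Gamma_D$. Outer loop: for all $i\in\mathbb N_0$ do: Inner loop: set $\boldsymbol n_h^{i,0}=\boldsymbol n_h^i$; for $\ell=0,1,2,\dots$, compute $\boldsymbol t_h^{i,\ell}\in\boldsymbol{\mathcal K}_h[\boldsymbol n_h^{i,\ell}]$ such that for all $\boldsymbol\phi_h\in\boldsymbol{\mathcal K}_h[\boldsymbol n_h^{i,\ell}]$ (G1) $\ \langle\boldsymbol t_h^{i,\ell},\boldsymbol\phi_h\rangle_*+\tau_{\boldsymbol n}\kappa\langle\boldsymbol t_h^{i,\ell}\otimes\nabla s_h^i,\boldsymbol\phi_h\otimes\nabla s_h^i\rangle+\tau_{\boldsymbol n}\langle s_h^i\nabla\boldsymbol t_h^{i,\ell},s_h^i\nabla\boldsymbol\phi_h\rangle=-\kappa\langle\boldsymbol n_h^{i,\ell}\otimes\nabla s_h^i,\boldsymbol\phi_h\otimes\nabla s_h^i\rangle-\langle s_h^i\nabla\boldsymbol n_h^{i,\ell},s_h^i\nabla\boldsymbol\phi_h\rangle$, and update $\boldsymbol n_h^{i,\ell+1}=\boldsymbol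 n_h^{i,\ell}+\tau_{\boldsymbol n}\boldsymbol t_h^{i,\ell}$; stop when (G2) $\ |E_1^h[s_h^i,\boldsymbol n_h^{i,\ell+1}]-E_1^h[s_h^i,\boldsymbol n_h^{i,\ell}]|<\mathsf{tol}$. Let $\ell_i\in\mathbb N_0$ be the smallest integer for which (G2) holds and set $\boldsymbol n_h^{i+1}=\boldsymbol n_h^{i,\ell_i+1}$. Then compute $s_h^{i+1}\in V_h$ with $s_h^{i+1}(z)=g_h(z)$ for all $z\in\mathcal N_h\cap\Gamma_D$ and, for all $w_h\in V_{h,D}$, (G3) $\ \langle d_ts_h^{i+1},w_h\rangle+\kappa\langle\boldsymbol n_h^{i+1}\otimes\nabla s_h^{i+1},\boldsymbol n_h^{i+1}\otimes\nabla w_h\rangle+\langle s_h^{i+1}\nabla\boldsymbol n_h^{i+1},w_h\nabla\boldsymbol n_h^{i+1}\rangle+\langle\psi_c'(s_h^{i+1}),w_h\rangle=\langle\psi_e'(s_h^i),w_h\rangle$. Output: the sequence $\{(s_h^i,\boldsymbol n_h^i)\}_{i\in\mathbb N_0}$.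
   Formalization: Blow-up of ψ contradicts ψ=ψ_c−ψ_e with ψ_c quadratic, so ψ, ψ_c, ψ_e (convex, ψ_e C¹) live on all of ℝ and ψ agrees with a double well only on a compact interval around 0 and s*; for the weighted H¹-metric some mesh vertex is assumed to lie on Γ_D, else (G1) can be singular. *)

(* Defs.v *)
From HB Require Import structures.
From mathcomp Require Import all_boot all_order all_algebra.
From mathcomp Require Import all_classical all_reals all_analysis.
Set Implicit Arguments.
Unset Strict Implicit.
Unset Printing Implicit Defensive.
Import Order.TTheory GRing.Theory Num.Theory.
Import numFieldNormedType.Exports.
Local Open Scope classical_set_scope.
Local Open Scope ring_scope.

(* Lebesgue measure on R^n = 'rV[R]_n, on the sigma-algebra generated by the
   coordinates (the Borel one), by iterated products; see lebesgue_rV_box. *)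
Section rV_measurable.
Context {R : realType} {n : nat}.

Let coord (i : 'I_n) (v : 'rV[R]_n) : R := v ord0 i.

HB.instance Definition _ := @isMeasurable.Build default_measure_display
  'rV[R]_n (g_sigma_preimage coord) (@sigma_algebra0 _ _ _)
  (@sigma_algebraC _ _) (@sigma_algebra_bigcup _ _ _).

Lemma measurable_coord (i : 'I_n) :
  measurable_fun [set: 'rV[R]_n] (fun v : 'rV[R]_n => v ord0 i).
Proof.
move=> _ Y mY; rewrite setTI; apply: sub_sigma_algebra => /=.
rewrite -bigcup_seq/=; exists i => /=; first by rewrite mem_index_enum.
by exists Y => //; rewrite setTI.
Qed.

Lemma measurable_fun_rV d (T : measurableType d) (f : T -> 'rV[R]_n) :
  (forall i, measurable_fun [set: T] (fun x => f x ord0 i)) ->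
  measurable_fun [set: T] f.
Proof.
move=> mf _ A mA; rewrite setTI.
suff: g_sigma_preimage (fun i x => coord i (f x)) `<=` @measurable _ T.
  apply; rewrite (g_sigma_preimage_comp coord f).
  by exists A => //; rewrite setTI.
apply: smallest_sub; first exact: sigma_algebra_measurable.
rewrite -bigcup_seq => B [i _] [C mC <-].
exact: mf.
Qed.

End rV_measurable.

Lemma product_measure1_sigma_finite d1 d2 (T1 : measurableType d1)
    (T2 : measurableType d2) (R : realType)
    (m1 : {sigma_finite_measure set T1 -> \bar R})
    (m2 : {sigma_finite_measure set T2 -> \bar R}) :
  sigma_finite setT (m1 \x m2)%E.
Proof.
have /sigma_finiteP[F [TF ndF Foo]] := sigma_finiteT m1.
have /sigma_finiteP[G [TG ndG Goo]] := sigma_finiteT m2.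
exists (fun n => F n `*` G n).
  rewrite -setXTT TF TG predeqE => -[x y]; split.
    move=> [/= [n _ Fnx] [k _ Gky]]; exists (maxn n k) => //; split.
    - by move: x Fnx; exact/subsetPset/ndF/leq_maxl.
    - by move: y Gky; exact/subsetPset/ndG/leq_maxr.
  by move=> [n _ []/= ? ?]; split; exists n.
move=> k; have [? ?] := Foo k; have [? ?] := Goo k.
split; first exact: measurableX.
by rewrite product_measure1E// lte_mul_pinfty// ge0_fin_numE.
Qed.

Section lebesgue_rV.
Context {R : realType}.

Definition rV_cons n (p : R * 'rV[R]_n) : 'rV[R]_n.+1 :=
  row_mx (p.1)%:M p.2.

Lemma measurable_rV_cons n :
  measurable_fun [set: measurableTypeR R * 'rV[R]_n] (@rV_cons n).
Proof.
apply: measurable_fun_rV => i.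
have [j ->|j ->] := @split_ordP 1 n i.
  have -> : (fun p => @rV_cons n p ord0 (lshift n j)) = fst.
    apply/funext => p; apply: etrans (@row_mxEl _ 1 1 n _ _ _ j) _.
    by rewrite (ord1 j) mxE.
  exact: measurable_fst.
have -> : (fun p => @rV_cons n p ord0 (rshift 1 j)) =
    (fun v : 'rV[R]_n => v ord0 j) \o snd.
  by apply/funext => p; exact: (@row_mxEr _ 1 1 n).
by apply: measurableT_comp; [exact: measurable_coord|exact: measurable_snd].
Qed.


Section step.
Variables (n : nat) (mu : {sigma_finite_measure set 'rV[R]_n -> \bar R}).

Let prod : {measure set (measurableTypeR R * 'rV[R]_n)%type -> \bar R} :=
  (@lebesgue_measure R \x mu)%E.

Definition lebesgue_rV_step : set 'rV[R]_n.+1 -> \bar R :=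
  pushforward (@lebesgue_measure R \x mu)%E (@rV_cons n).

Let step0 : lebesgue_rV_step set0 = 0%E.
Proof. by rewrite /lebesgue_rV_step /pushforward preimage_set0 measure0. Qed.

Let step_ge0 A : (0 <= lebesgue_rV_step A)%E.
Proof. exact: (@measure_ge0 _ _ _ prod). Qed.

Let step_sigma_additive : semi_sigma_additive lebesgue_rV_step.
Proof.
move=> F mF tF mUF; rewrite /lebesgue_rV_step /pushforward preimage_bigcup.
have mpre A : measurable A -> measurable (@rV_cons n @^-1` A).
  by move=> mA; rewrite -[X in measurable X]setTI; exact: measurable_rV_cons.
apply: (@measure_semi_sigma_additive _ _ _ prod).
- by move=> k; exact: mpre.
- apply/trivIsetP => /= i j _ _ ij; rewrite -preimage_setI.
  by move/trivIsetP : tF => /(_ _ _ _ _ ij) ->//; rewrite preimage_set0.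
- by rewrite -preimage_bigcup; exact: mpre.
Qed.

HB.instance Definition _ := isMeasure.Build _ _ _
  lebesgue_rV_step step0 step_ge0 step_sigma_additive.

Let step_sigma_finite : sigma_finite setT lebesgue_rV_step.
Proof.
have [F FT mF] := product_measure1_sigma_finite (@lebesgue_measure R) mu.
pose split_rV (v : 'rV[R]_n.+1) : measurableTypeR R * 'rV[R]_n :=
  (v ord0 ord0, \row_i v ord0 (lift ord0 i)).
have rV_consK : cancel (@rV_cons n) split_rV.
  move=> [x v]; rewrite /split_rV; congr pair.
    have -> : ord0 = lshift n (ord0 : 'I_1) :> 'I_(1 + n) by exact: val_inj.
    by apply: etrans (@row_mxEl _ 1 1 n _ _ _ _) _; rewrite mxE.
  apply/rowP => i; rewrite mxE.
  have -> : lift ord0 i = rshift 1 i :> 'I_(1 + n) by exact: val_inj.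
  exact: (@row_mxEr _ 1 1 n).
have msplit : measurable_fun setT split_rV.
  apply: measurable_fun_pair; first exact: measurable_coord.
  apply: measurable_fun_rV => i.
  have -> : (fun v : 'rV[R]_n.+1 =>
      (\row_i v ord0 (lift ord0 i) : 'rV[R]_n) ord0 i) =
      (fun v => v ord0 (lift ord0 i)) by apply/funext => v; rewrite mxE.
  exact: measurable_coord.
exists (fun k => split_rV @^-1` F k); first by rewrite -preimage_bigcup -FT.
move=> k; have [mFk Fk] := mF k; split.
  by rewrite -[X in measurable X]setTI; exact: msplit.
rewrite /lebesgue_rV_step /pushforward -comp_preimage.
by rewrite (_ : _ \o _ = id) ?preimage_id//; apply/funext => p; exact: rV_consK.
Qed.

HB.instance Definition _ := @Measure_isSigmaFinite.Build _ _ _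
  lebesgue_rV_step step_sigma_finite.

End step.

Fixpoint lebesgue_rV_rec n : {sigma_finite_measure set 'rV[R]_n -> \bar R} :=
  match n with
  | 0 => \d_ (0 : 'rV[R]_0)
  | n'.+1 => lebesgue_rV_step (lebesgue_rV_rec n')
  end.

Definition lebesgue_rV n : set 'rV[R]_n -> \bar R := lebesgue_rV_rec n.

HB.instance Definition _ n := SigmaFiniteMeasure.on (@lebesgue_rV n).

Lemma lebesgue_rV_box n (A : 'I_n -> set R) : (forall i, measurable (A i)) ->
  lebesgue_rV [set v : 'rV[R]_n | forall i, A i (v ord0 i)] =
  (\prod_(i < n) @lebesgue_measure R (A i))%E.
Proof.
elim: n A => [|n IH] A mA.
  by rewrite big_ord0 /lebesgue_rV /= diracE mem_set// => -[].
rewrite big_ord_recl -IH//.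
rewrite [LHS]/lebesgue_rV /= /lebesgue_rV_step /pushforward.
have -> : @rV_cons n @^-1` [set v | forall i, A i (v ord0 i)] =
  A ord0 `*` [set v : 'rV[R]_n | forall i, A (lift ord0 i) (v ord0 i)].
  have E0 (p : R * 'rV[R]_n) : rV_cons p ord0 ord0 = p.1.
    have -> : ord0 = lshift n (ord0 : 'I_1) :> 'I_(1 + n) by exact: val_inj.
    by apply: etrans (@row_mxEl _ 1 1 n _ _ _ _) _; rewrite mxE.
  have E1 (p : R * 'rV[R]_n) i : rV_cons p ord0 (lift ord0 i) = p.2 ord0 i.
    have -> : lift ord0 i = rshift 1 i :> 'I_(1 + n) by exact: val_inj.
    exact: (@row_mxEr _ 1 1 n).
  apply/seteqP; split => [p /= H|p /= [H1 H2] i].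
    by split => [|i]; [rewrite -E0|rewrite -E1]; exact: H.
  by have [j ->|->] := unliftP ord0 i; [rewrite E1|rewrite E0].
apply: (product_measure1E (@lebesgue_measure R) (lebesgue_rV_rec n)); first exact: mA.
rewrite [X in measurable X](_ : _ = \bigcap_(i in [set: 'I_n])
    ((fun v : 'rV[R]_n => v ord0 i) @^-1` A (lift ord0 i))).
  apply: fin_bigcap_measurable => // i _.
  by rewrite -[X in measurable X]setTI; exact: measurable_coord.
by apply/seteqP; split => v /= H i; [move=> _|]; exact: H.
Qed.

End lebesgue_rV.

Section euclidean.
Context {R : realType}.

(* Frobenius product; for 'rV it is the Euclidean scalar product.  The norm
   `|.| that the library puts on matrices is the max norm. *)
Definition frob p q (A B : 'M[R]_(p, q)) : R := \sum_i \sum_j A i j * B i j.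

Definition enorm p q (A : 'M[R]_(p, q)) : R := Num.sqrt (frob A A).

Definition tensor p q (a : 'rV[R]_p) (b : 'rV[R]_q) : 'M[R]_(p, q) :=
  \matrix_(i, j) (a ord0 i * b ord0 j).

Variable d : nat.
Implicit Types A : set 'rV[R]_d.

Definition ediam A : \bar R :=
  ereal_sup (0%E |` [set (enorm (p.1 - p.2))%:E | p in A `*` A]).

Definition hausdorff_pre (k : nat) (delta : R) A : \bar R :=
  ereal_inf [set (\sum_(0 <= j <oo) ediam (U j) ^+ k)%E | U in
    [set U : (set 'rV[R]_d)^nat |
       A `<=` \bigcup_j U j /\ forall j, (ediam (U j) <= delta%:E)%E]].

Definition hausdorff_measure (k : nat) A : \bar R :=
  ereal_sup [set hausdorff_pre k delta A | delta in [set e : R | 0 < e]].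

(* Convex hull of the points p i, i in S. *)
Definition hull n (p : 'I_n -> 'rV[R]_d) (S : {set 'I_n}) : set 'rV[R]_d :=
  [set x | exists lam : 'I_n -> R,
    [/\ forall i, 0 <= lam i, forall i, i \notin S -> lam i = 0,
        \sum_i lam i = 1 & x = \sum_i lam i *: p i]].

Definition affinely_independent n (p : 'I_n -> 'rV[R]_d) (S : {set 'I_n}) :=
  forall lam : 'I_n -> R, (forall i, i \notin S -> lam i = 0) ->
    \sum_i lam i = 0 -> \sum_i lam i *: p i = 0 -> forall i, lam i = 0.

End euclidean.

Section domain.
Context {R : realType} {d : nat}.
Implicit Types Omega : set 'rV[R]_d.

Definition bdry Omega := closure Omega `\` Omega^°.

(* Near x0, Omega lies above the graph of the Lipschitz function phi over the
   hyperplane orthogonal to the unit vector e. *)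
Definition lipschitz_boundary Omega := forall x0 : 'rV[R]_d, bdry Omega x0 ->
  exists (e : 'rV[R]_d) (phi : 'rV[R]_d -> R),
    [/\ enorm e = 1, lipschitz phi,
        forall (x : 'rV[R]_d) (t : R), phi (x + t *: e) = phi x &
        \forall x \near x0, Omega x <-> phi x < frob x e].

Definition polytopal Omega :=
  exists n (p : 'I_n -> 'rV[R]_d) (F : {set {set 'I_n}}),
    closure Omega = \bigcup_(S in [set` F]) hull p S.

Definition lipschitz_polytopal_domain Omega :=
  [/\ open Omega, connected Omega, Omega !=set0 & bounded_set Omega] /\
  lipschitz_boundary Omega /\ polytopal Omega.

Record mesh := Mesh {
  nvert : nat;
  vert : 'I_nvert -> 'rV[R]_d;
  elems : {set {set 'I_nvert}} }.

Definition cell (T : mesh) (K : {set 'I_(nvert T)}) : set 'rV[R]_d :=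
  hull (@vert T) K.

Definition simplicial_mesh Omega (T : mesh) :=
  [/\ injective (@vert T),
      forall z, exists2 K, K \in elems T & z \in K,
      forall K, K \in elems T -> #|K| = d.+1 /\ affinely_independent (@vert T) K,
      forall K K', K \in elems T -> K' \in elems T ->
        cell K `&` cell K' = cell (K :&: K') &
      closure Omega = \bigcup_(K in [set` elems T]) cell K].

Definition mesh_size (T : mesh) : R :=
  \big[Num.max/0]_(K in elems T) fine (ediam (cell K)).

Definition shape_regular_family Omega (F : set mesh) :=
  exists sigma : R, forall T, F T -> simplicial_mesh Omega T /\
    forall K, K \in elems T -> exists (c : 'rV[R]_d) (rho : R),
      [/\ 0 < rho, [set x | enorm (x - c) < rho] `<=` cell K &
          fine (ediam (cell K)) <= sigma * rho].

End domain.
Arguments mesh : clear implicits.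

Section potential.
Context {R : realType}.

Definition convexR (f : R -> R) :=
  @convex_function R R^o [set: convex_lmodType R^o] f.

(* The double well potential; only its values on ]-1/(d-1), 1[ matter. *)
Definition double_well (d : nat) (psi : R -> R) :=
  let a : R := - (d%:R - 1)^-1 in
  [/\ (forall s : R, a < s < 1 -> 0 <= psi s),
      (forall s : R, a < s < 1 -> [/\ derivable psi s 1, derivable (derive1 psi) s 1 &
                                 {for s, continuous (derive1 (derive1 psi))}]),
      psi s @[s --> 1^'-] --> +oo /\ psi s @[s --> a^'+] --> +oo,
      exists s0 : R, [/\ 0 < s0 < 1, psi s0 < psi 0, psi s0 = 0 &
                     forall s : R, a < s < 1 -> psi s0 <= psi s] &
      derive1 psi 0 = 0].

(* A convex function on ]-1/(d-1), 1[ is bounded below, so no psi with the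
   blow-up of double_well is there the difference of a quadratic and a convex
   function.  A split potential, which is evaluated at finite element functions
   with values in all of R, therefore agrees with a double well on a compact
   subinterval containing both 0 and a minimizer only. *)
Definition double_well_extension (d : nat) (psi : R -> R) :=
  exists (psi0 : R -> R) (lo hi s0 : R),
    [/\ double_well d psi0, - (d%:R - 1)^-1 < lo < 0,
        0 < s0 < hi /\ hi < 1, psi0 s0 = 0 &
        forall s : R, lo <= s <= hi -> psi s = psi0 s].

Definition convex_splitting (psi psi_c psi_e : R -> R) :=
  [/\ forall s : R, psi s = psi_c s - psi_e s, convexR psi_c, convexR psi_e,
      exists a b c : R, forall s : R, psi_c s = a * s ^+ 2 + b * s + c &
      (forall s : R, derivable psi_e s 1) /\ continuous (derive1 psi_e)].

End potential.

(* W^{1,oo}(R^d) is identified with the bounded Lipschitz functions, the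
   continuous representatives, which have nodal values. *)
Definition W1oo {R : realType} {d : nat} {V : normedModType R}
    (f : 'rV[R]_d -> V) := bounded_fun f /\ lipschitz f.

Definition Loo {R : realType} {d p : nat} (f : 'rV[R]_d -> 'rV[R]_p) :=
  measurable_fun setT f /\
  exists M : R, {ae @lebesgue_rV R d, forall x, enorm (f x) <= M}.

Inductive metric (R : realType) := L2_metric | H1_metric of R.
Arguments L2_metric {R}.

Record problem (R : realType) (d : nat) := Problem {
  Omega : set 'rV[R]_d;
  GammaD : set 'rV[R]_d;
  Th : mesh R d;
  kappa : R;
  gdat : 'rV[R]_d -> R;
  rdat : 'rV[R]_d -> 'rV[R]_d;
  psi : R -> R;
  psi_c : R -> R;
  psi_e : R -> R;
  star : metric R;
  tau_n : R;
  tau_s : R;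
  tol : R }.

Section algorithm.
Context {R : realType} {d : nat} (P : problem R d).
Local Notation T := (Th P).
Local Notation E := 'rV[R]_d.
Local Notation scalar := (E -> R).
Local Notation vector := (E -> E).

Definition node (z : 'I_(nvert T)) : E := vert z.

(* Functions on the closure of Omega are extended by zero, so that they are
   equal as soon as they agree there. *)
Definition Vh : set scalar :=
  [set v | [/\ {within closure (Omega P), continuous v},
    forall K, K \in elems T -> exists (a : E) (b : R),
      forall x, cell K x -> v x = frob a x + b &
    forall x, ~ closure (Omega P) x -> v x = 0]].

Definition Vhd : set vector := [set v | forall j, Vh (fun x => v x ord0 j)].

Definition interpolant (f : scalar) : scalar :=
  xget (fun=> 0) [set v | Vh v /\ forall z, v (node z) = f (node z)].

Definition interpolantd (f : vector) : vector :=
  fun x => \row_j interpolant (fun y => f y ord0 j) x.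

Definition gh := interpolant (gdat P).
Definition rh := interpolantd (rdat P).

Definition VhD : set scalar :=
  [set v | Vh v /\ forall z, GammaD P (node z) -> v (node z) = 0].

Definition VhDd : set vector := [set v | forall j, VhD (fun x => v x ord0 j)].

Definition Kh (n : vector) : set vector :=
  [set phi | VhDd phi /\ forall z, frob (n (node z)) (phi (node z)) = 0].

(* Gradients are taken inside the elements; the value 0 on the skeleton of the
   mesh, a null set, is immaterial. *)
Definition inside_elem : set E :=
  \bigcup_(K in [set` elems T]) (cell K)^°.

Definition grad (f : scalar) (x : E) : E :=
  \row_j (if x \in inside_elem then 'D_(delta_mx ord0 j) f x else 0).

Definition gradd (f : vector) (x : E) : 'M[R]_d :=
  \matrix_(i, j) grad (fun y => f y ord0 i) x ord0 j.

Definition integral_Omega (f : E -> R) : R :=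
  (\int[@lebesgue_rV R d]_(x in Omega P) f x)%R.

Definition ips (f k : scalar) : R := integral_Omega (fun x => f x * k x).

Definition ip p q (F G : E -> 'M[R]_(p, q)) : R :=
  integral_Omega (fun x => frob (F x) (G x)).

Definition ip_star (phi chi : vector) : R :=
  match star P with
  | L2_metric => ip phi chi
  | H1_metric alpha =>
      ip (fun x => (mesh_size T `^ alpha) *: gradd phi x) (gradd chi)
  end.

(* The weighted H1 form is definite on VhDd iff some node lies on GammaD, which
   |GammaD| > 0 does not ensure on a coarse mesh.  Without such a node VhD
   contains the constants and, for s and n constant, G1 is singular. *)
Definition admissible_metric :=
  match star P with
  | L2_metric => True
  | H1_metric alpha => 0 < alpha <= 2 /\ exists z, GammaD P (node z)
  end.

Definition norm_star (phi : vector) : R := Num.sqrt (ip_star phi phi).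

Definition norm_L2 (f : scalar) : R := Num.sqrt (ips f f).

Definition E1 (s : scalar) (n : vector) : R :=
  2^-1 * integral_Omega (fun x =>
    kappa P * enorm (tensor (n x) (grad s x)) ^+ 2 +
    s x ^+ 2 * enorm (gradd n x) ^+ 2).

Definition E2 (s : scalar) : R := integral_Omega (fun x => psi P (s x)).

Definition Eh (s : scalar) (n : vector) : R := E1 s n + E2 s.

Definition tens_grad (n : vector) (s : scalar) : E -> 'M[R]_d :=
  fun x => tensor (n x) (grad s x).

Definition scaled_grad (s : scalar) (n : vector) : E -> 'M[R]_d :=
  fun x => s x *: gradd n x.

Definition input (s0 : scalar) (n0 : vector) :=
  [/\ Vh s0, Vhd n0, forall z, enorm (n0 (node z)) = 1 &
    forall z, GammaD P (node z) ->
      n0 (node z) = (gh (node z))^-1 *: rh (node z) /\ s0 (node z) = gh (node z)].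

Definition G1 (s : scalar) (n t : vector) :=
  Kh n t /\ forall phi, Kh n phi ->
    ip_star t phi
    + tau_n P * kappa P * ip (tens_grad t s) (tens_grad phi s)
    + tau_n P * ip (scaled_grad s t) (scaled_grad s phi)
    = - kappa P * ip (tens_grad n s) (tens_grad phi s)
      - ip (scaled_grad s n) (scaled_grad s phi).

Definition G2 (s : scalar) (n n' : vector) := `|E1 s n' - E1 s n| < tol P.

Definition dt (s s' : scalar) : scalar := fun x => (s' x - s x) / tau_s P.

Definition G3 (s : scalar) (n' : vector) (s' : scalar) :=
  [/\ Vh s', forall z, GammaD P (node z) -> s' (node z) = gh (node z) &
    forall w, VhD w ->
      ips (dt s s') w
      + kappa P * ip (tens_grad n' s') (tens_grad n' w)
      + ip (scaled_grad s' n') (scaled_grad w n')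
      + ips (fun x => derive1 (psi_c P) (s' x)) w
      = ips (fun x => derive1 (psi_e P) (s x)) w].

(* The first l steps of the inner loop started at n: nn k and t k stand for
   n_h^{i,k} and t_h^{i,k}; entries of index > l of nn, >= l of t are
   irrelevant. *)
Definition inner_run (s : scalar) (n : vector) (l : nat)
    (nn t : nat -> vector) :=
  nn 0%N = n /\ forall k, (k < l)%N ->
    G1 s (nn k) (t k) /\ nn k.+1 = (fun x => nn k x + tau_n P *: t k x).

(* The inner loop stops with l_i = l. *)
Definition inner_loop (s : scalar) (n : vector) (l : nat)
    (nn t : nat -> vector) :=
  [/\ inner_run s n l.+1 nn t, G2 s (nn l) (nn l.+1) &
    forall k, (k < l)%N -> ~ G2 s (nn k) (nn k.+1)].

(* (s_h^i, n_h^i) is a pair produced by the algorithm. *)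
Inductive iterate (s0 : scalar) (n0 : vector) :
    nat -> scalar -> vector -> Prop :=
| iterate0 : iterate s0 n0 0 s0 n0
| iterateS i s n l nn t s' :
    iterate s0 n0 i s n -> inner_loop s n l nn t -> G3 s (nn l.+1) s' ->
    iterate s0 n0 i.+1 s' (nn l.+1).

End algorithm.

(* Main.v *)
(* Each step of the algorithm is the Riesz representation problem of a
   symmetric positive definite form on a space of finite element functions.
   Such a function is determined by its nodal values, so nodal evaluation
   separates points, which is all the finite-dimensionality that is needed; no
   nodal basis is constructed, and s_h^i itself serves as the lift of the
   Dirichlet data in (G3).  Testing (G1) with t_h and (G3) with
   s_h^{i+1} - s_h^i gives the energy law; the convex splitting is evaluated
   with tangent inequalities at s_h^{i+1} (for psi_c) and s_h^i (for psi_e).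
   The inner loop stops since otherwise E_1^h would decrease by at least tol at
   every iteration. *)
Require Import Defs.
From mathcomp Require Import all_boot all_order all_algebra.
From mathcomp Require Import all_classical all_reals all_analysis.
From mathcomp Require Import measurable_realfun ring lra.
Set Implicit Arguments.
Unset Strict Implicit.
Unset Printing Implicit Defensive.
Import Order.TTheory GRing.Theory Num.Theory.
Import numFieldNormedType.Exports.
Local Open Scope classical_set_scope.
Local Open Scope ring_scope.

(** * Representation of linear functionals *)

Section riesz.
Context {R : realFieldType} {V : lmodType R}.
Implicit Types (X : set V) (a : V -> V -> R) (F : V -> R).

(** The substance lies in definiteness: functions are compared as plain maps on R^d, while the forms
    are integrals. The zero extension settles the points off the closure of Omega; inside,
    continuity turns one nonzero value into a lower bound on a nonempty open set, and such sets have
    positive measure. The weighted H1 metric sees only gradients, and there connectedness of the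
    domain together with a node on the Dirichlet part takes over. Integrability is handled once:
    every integrand is bounded and measurable on a set of finite measure, a class closed under
    products. As gradients are set to 0 on the mesh skeleton, the algebraic identities hold at every
    point and no null set has to be discarded. Because [psi_c] is quadratic, (G3) is linear in the
    increment, and convexity makes the added coefficient nonnegative, so no smallness of the time
    step enters. The terms with the squared time steps in the energy law are the remainders of
    expanding a quadratic form. The iterates form a relation, so well-posedness includes that the
    outcome of the inner loop, hence the next pair, is determined by the current one. *)

Definition subspace_of X := X 0 /\ forall c u v, X u -> X v -> X (c *: u + v).

Definition linear_on X F :=
  forall c u v, X u -> X v -> F (c *: u + v) = c * F u + F v.

Definition spd_on X a :=
  [/\ forall w, X w -> linear_on X (a ^~ w),
      forall u v, X u -> X v -> a u v = a v u &
      forall u, X u -> u != 0 -> 0 < a u u].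

Lemma subspaceZ X c u : subspace_of X -> X u -> X (c *: u).
Proof. by move=> [X0 XD] Xu; rewrite -[_ *: u]addr0; exact: XD. Qed.

Lemma subspaceD X u v : subspace_of X -> X u -> X v -> X (u + v).
Proof. by move=> [X0 XD] Xu Xv; rewrite -[u]scale1r; exact: XD. Qed.

Lemma subspaceB X u v : subspace_of X -> X u -> X v -> X (u - v).
Proof.
by move=> [X0 XD] Xu Xv; rewrite addrC -scaleN1r; exact: XD.
Qed.

Lemma linear_on0 X F : X 0 -> linear_on X F -> F 0 = 0.
Proof.
move=> X0 /(_ 1 0 0 X0 X0); rewrite scale1r addr0 mul1r => /eqP.
by rewrite -subr_eq0 opprD addrA subrr sub0r oppr_eq0 => /eqP.
Qed.

Lemma linear_onZ X F c u : X 0 -> linear_on X F -> X u ->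
  F (c *: u) = c * F u.
Proof. by move=> X0 lF Xu; rewrite -[_ *: u]addr0 lF// (linear_on0 X0 lF) addr0. Qed.

Lemma linear_onD X F u v : linear_on X F -> X u -> X v -> F (u + v) = F u + F v.
Proof. by move=> lF Xu Xv; rewrite -[u]scale1r lF// mul1r scale1r. Qed.

Lemma linear_onB X F u v : linear_on X F -> X u -> X v -> F (u - v) = F u - F v.
Proof.
by move=> lF Xu Xv; rewrite addrC -scaleN1r lF// mulN1r addrC.
Qed.

(* Instead of a basis, finite dimension is given by finitely many linear
   functionals separating the points: restricting to the kernel of one of them
   and taking the orthogonal projection onto that kernel gives the induction
   step. *)
Lemma riesz_representation (I : eqType) (s : seq I) (e : I -> V -> R) X a F :
  subspace_of X -> (forall i, linear_on X (e i)) ->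
  (forall u, X u -> (forall i, i \in s -> e i u = 0) -> u = 0) ->
  spd_on X a -> linear_on X F ->
  exists2 u, X u & forall v, X v -> a u v = F v.
Proof.
elim: s X F => [|i s IH] X F [X0 XD] le sep [la sa pa] lF.
  exists 0 => // v Xv; have -> : v = 0 by exact: sep.
  by rewrite (linear_on0 X0 lF) (linear_on0 X0 (la _ X0)).
pose Y : set V := [set u | X u /\ e i u = 0].
have YX u : Y u -> X u by case.
have sY : subspace_of Y.
  split; first by split => //; exact: linear_on0 (le i).
  move=> c u v [Xu eu] [Xv ev]; split; first exact: XD.
  by rewrite le// eu ev mulr0 addr0.
have lY G : linear_on X G -> linear_on Y G.
  by move=> lG c u v /YX Xu /YX Xv; exact: lG.
have sepY u : Y u -> (forall j, j \in s -> e j u = 0) -> u = 0.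
  move=> [Xu eu] H; apply: sep => // j; rewrite in_cons => /predU1P[->//|].
  exact: H.
have aY : spd_on Y a.
  split; first by move=> w /YX Xw; exact/lY/la.
  - by move=> u v /YX Xu /YX Xv; exact: sa.
  - by move=> u /YX Xu; exact: pa.
have {}IH G : linear_on X G -> exists2 u, Y u & forall v, Y v -> a u v = G v.
  by move=> lG; apply: IH => // [j|]; exact: lY.
have [u0 Yu0 u0P] := IH F lF.
(* If [e i] vanishes on all of [X], then [Y] is [X] and [u0] already represents [F]. *)
have [[b [Xb eb]]|nb] := pselect (exists b, X b /\ e i b != 0); last first.
  exists u0; first exact: YX.
  move=> v Xv; apply: u0P; split => //; apply/eqP/negP => /negP ev.
  by apply: nb; exists v.
have lab : linear_on X (a b).
  by move=> c u v Xu Xv; rewrite !(sa b)//; [exact: la|exact: XD].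
(* Representing [a b] on the kernel [Y] gives the [a]-orthogonal projection [p] of [b]; then [b - p]
   spans the orthogonal complement of [Y] in [X]. *)
have [p Yp pP] := IH (a b) lab.
have Xp := YX _ Yp.
have Xr : X (b - p) by exact: subspaceB.
set r := b - p in Xr.
have er : e i r = e i b by rewrite (linear_onB (le i))// Yp.2 subr0.
have orth y : Y y -> a r y = 0.
  by move=> Yy; rewrite (linear_onB (la _ (YX _ Yy)))// pP// subrr.
have rr : 0 < a r r.
  apply: pa => //; apply: contraNneq eb => r0; rewrite -er r0.
  by rewrite (linear_on0 X0 (le i)).
(* The problem decouples along [r] and on [Y], so the representer is the sum of the two partial
   ones. Since [e i r = e i b], the coefficient [c] below puts [v - c *: r] into [Y]. *)
exists (F r / a r r *: r + u0); first by apply: XD => //; exact: YX.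
move=> v Xv; pose c := e i v / e i b.
have Yy : Y (v - c *: r).
  have Xcr : X (c *: r) by exact: subspaceZ.
  split; first exact: subspaceB.
  by rewrite (linear_onB (le i))// (linear_onZ _ X0 (le i))// er divfK// subrr.
set y := v - c *: r in Yy.
have Xy := YX _ Yy.
have -> : v = c *: r + y by rewrite addrC subrK.
have Xcy : X (c *: r + y) by exact: XD.
have Xu0 := YX _ Yu0.
have split_v w : X w -> a w (c *: r + y) = c * a w r + a w y.
  by move=> Xw; rewrite sa// la// [a r w]sa// [a y w]sa.
rewrite la// !split_v// lF// (orth y)// (u0P y)// [a u0 r]sa// (orth u0)//.
by rewrite addr0 mulr0 add0r mulrCA divfK ?gt_eqF.
Qed.

Lemma riesz_representation_unique X a F u u' :
  subspace_of X -> spd_on X a ->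
  X u -> (forall v, X v -> a u v = F v) ->
  X u' -> (forall v, X v -> a u' v = F v) -> u = u'.
Proof.
move=> sX [la _ pa] Xu uP Xu' u'P; apply/eqP; rewrite -subr_eq0.
apply/negP => /negP ne0; have Xd : X (u - u') by exact: subspaceB.
have := pa _ Xd ne0.
by rewrite (linear_onB (la _ Xd))// uP// u'P// subrr ltxx.
Qed.

End riesz.

(** * Lebesgue measure and the topology of R^d *)

Section rV_measure.
Context {R : realType} {d : nat}.
Local Notation E := 'rV[R]_d.
Local Notation mu := (@lebesgue_rV R d).

(** The [ball] on row vectors belongs to the max norm, hence is a cube, to which the product formula
    for the measure applies. *)
Lemma rV_ballE (x : E) (e : R) : 0 < e ->
  ball x e = [set v | forall i, ball (x ord0 i) e (v ord0 i)].
Proof.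
move=> e0; apply/seteqP; split => [v [_ H] i|v H]; first exact: H.
by split => // i j; rewrite (ord1 i); exact: H.
Qed.

Lemma measurable_rV_ball (x : E) (e : R) : 0 < e -> measurable (ball x e).
Proof.
move=> e0; rewrite rV_ballE// [X in measurable X](_ : _ =
    \bigcap_(i in [set: 'I_d]) ((fun v : E => v ord0 i) @^-1` ball (x ord0 i) e)).
  apply: fin_bigcap_measurable => // i _.
  rewrite -[X in measurable X]setTI; apply: measurable_coord => //.
  by rewrite ball_itv; exact: measurable_itv.
by apply/seteqP; split => v /= H i; [move=> _|]; exact: H.
Qed.

Lemma lebesgue_rV_ball (x : E) (e : R) : 0 < e ->
  mu (ball x e) = ((e *+ 2) ^+ d)%:E.
Proof.
move=> e0; rewrite rV_ballE//.
rewrite (lebesgue_rV_box (A := fun i => ball (x ord0 i) e)); last first.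
  by move=> i; rewrite ball_itv; exact: measurable_itv.
rewrite (eq_bigr (fun=> (e *+ 2)%:E)); last first.
  by move=> i _; exact: (lebesgue_measure_ball (x ord0 i) (ltW e0)).
by rewrite prodEFin prodr_const card_ord.
Qed.

(** The sigma-algebra is generated by the coordinates, so second countability has to be used: an
    open set is the union of those cubes with rational centre and radius [1/(n+1)] that it
    contains. *)
Lemma open_rV_measurable (U : set E) : open U -> measurable U.
Proof.
move=> oU.
pose B (k : 'rV[rat]_d * nat) : set E :=
  ball (map_mx ratr k.1 : E) (k.2.+1%:R^-1).
(* Cubes that leave [U] become empty, so that the union runs over a whole countable type. *)
pose F k := if `[< B k `<=` U >] then B k else set0.
have -> : U = \bigcup_k F k.
  apply/seteqP; split=> [x Ux|x [k _]]; last first.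
    by rewrite /F; case: asboolP => // + Bx; exact.
  have /nbhs_ballP[e /= e0 eU] : nbhs x U by exact: open_nbhs_nbhs.
  have [n ne] : exists n : nat, n.+1%:R^-1 < e / 2.
    have e2 : 0 < e / 2 by rewrite divr_gt0.
    by have [n _ /(_ n (leqnn n))] := near_infty_natSinv_lt (PosNum e2); exists n.
  have n0 : (0 : R) < n.+1%:R^-1 by rewrite invr_gt0.
  have /choice[q qP] (i : 'I_d) : exists q : rat, ball (x ord0 i) n.+1%:R^-1 (ratr q).
    have [|q qx] := @rat_in_itvoo R (x ord0 i - n.+1%:R^-1) (x ord0 i + n.+1%:R^-1).
      by rewrite ltrBlDr -addrA ltrDl addr_gt0.
    by exists q; rewrite ball_itv.
  pose c : 'rV[rat]_d := \row_i q i.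
  have xc : B (c, n) x.
    rewrite /B/= rV_ballE// => i; rewrite !mxE; apply: ball_sym; exact: qP.
  exists (c, n) => //; rewrite /F; case: asboolP => // -[] y cy.
  apply: eU; apply: (@le_ball _ _ _ (n.+1%:R^-1 + n.+1%:R^-1)).
    by rewrite [e]splitr lerD// ltW.
  by apply: ball_triangle cy; apply: ball_sym.
apply: countable_bigcupT_measurable; first exact: countableP.
move=> k; rewrite /F; case: ifP => // _.
by apply: measurable_rV_ball; rewrite invr_gt0.
Qed.

Lemma lebesgue_rV_open_gt0 (U : set E) : open U -> U !=set0 -> (0 < mu U)%E.
Proof.
move=> oU [x Ux]; have /nbhs_ballP[e /= e0 eU] : nbhs x U by exact: open_nbhs_nbhs.
apply: (@lt_le_trans _ _ (mu (ball x e))).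
  by rewrite lebesgue_rV_ball// lte_fin exprn_gt0// mulrn_wgt0.
apply: le_measure => //; rewrite inE; first exact: measurable_rV_ball.
exact: open_rV_measurable.
Qed.

Lemma lebesgue_rV_bounded_lty (U : set E) : measurable U -> bounded_set U ->
  (mu U < +oo)%E.
Proof.
move=> mU [M [_ MU]]; have M0 : 0 < `|M| + 2 by rewrite ltr_wpDl.
apply: (@le_lt_trans _ _ (mu (ball (0 : E) (`|M| + 2)))); last first.
  by rewrite lebesgue_rV_ball// ltry.
apply: le_measure; rewrite ?inE//; first exact: measurable_rV_ball.
move=> x Ux; rewrite -ball_normE /= sub0r normrN.
apply: (@le_lt_trans _ _ (`|M| + 1)); last by rewrite ltrD2l ltr1n.
by apply: MU => //; rewrite ltr_pwDr// ler_norm.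
Qed.

End rV_measure.

(** * Convex potentials *)

Section convex_potential.
Context {R : realType}.
Implicit Types f : R -> R.

Lemma convexR_le f (x y t : R) : convexR f -> 0 <= t -> t <= 1 ->
  f (x + t * (y - x)) <= f x + t * (f y - f x).
Proof.
move=> cf t0 t1.
have {}cf : f (t * y + (1 - t) * x) <= t * f y + (1 - t) * f x.
  by have := cf (Itv01 t0 t1) y x; rewrite !inE => /(_ I I).
rewrite (_ : x + _ = t * y + (1 - t) * x); last by ring.
by rewrite (_ : f x + _ = t * f y + (1 - t) * f x); last by ring.
Qed.

(** By convexity the increment of [f] from [x] to [x + t(y - x)] is at most [t (f y - f x)]; divide
    by [t] and let [t] tend to 0 from the right. The slope function [g] of Carathéodory, continuous
    at [x], writes that increment as an exact multiple of [t]. *)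
Lemma convexR_tangent f (x y : R) : convexR f -> derivable f x 1 ->
  derive1 f x * (y - x) <= f y - f x.
Proof.
move=> cf df.
have /is_derive1_caratheodory[g [gE cg <-]] : is_derive x 1 f (derive1 f x).
  by rewrite derive1E; exact/derivableP.
have h : g (x + t * (y - x)) * (y - x) @[t --> 0^'+] --> g x * (y - x).
  have h : {for (0 : R), continuous (fun t : R => g (x + t * (y - x)))}.
    apply: continuous_comp; last by rewrite mul0r addr0.
    by apply: cvgD; [exact: cvg_cst|apply: cvgMl; exact: cvg_id].
  by have := cvg_at_right_filter h; rewrite mul0r addr0; exact: cvgMl.
rewrite -(cvg_lim _ h)//; apply: limr_le; first by apply/cvg_ex; eexists; exact: h.
near=> t; have t0 : 0 < t by [].
have gt : t * (g (x + t * (y - x)) * (y - x)) = f (x + t * (y - x)) - f x.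
  by rewrite gE; ring.
by rewrite -(ler_pM2l t0) gt lerBlDl; apply: convexR_le => //; exact: ltW.
Unshelve. all: by end_near.
Qed.

(** The midpoint inequality between -1 and 1 reads [c <= a + c]. *)
Lemma convexR_quadratic_ge0 f (a b c : R) : convexR f ->
  (forall s, f s = a * s ^+ 2 + b * s + c) -> 0 <= a.
Proof.
move=> cf fE; have := @convexR_le f (-1) 1 2^-1 cf.
rewrite !fE => H; suff : 0 <= 2 * a by lra.
have := H ltac:(lra) ltac:(lra).
rewrite (_ : -1 + 2^-1 * (1 - -1) = 0); last by field.
lra.
Qed.

Lemma derive1_quadratic f (a b c : R) :
  (forall s, f s = a * s ^+ 2 + b * s + c) ->
  derive1 f = (fun s => 2 * a * s + b).
Proof.
move=> fE; have -> : f = (fun s => a * s ^+ 2 + b * s + c) by exact/funext.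
apply/funext => s; rewrite derive1E.
apply: (@derive_val _ _ _ _ _ _ _ _); apply/is_derive1_caratheodory.
exists (fun z => a * (z + s) + b); split; [by move=> z; ring| |by ring].
by apply: cvgD; [apply: cvgMr; apply: cvgD; [exact: cvg_id|]|]; exact: cvg_cst.
Qed.

End convex_potential.

(** * Integration of bounded measurable functions *)

Section bounded_measurable.
Context {disp : measure_display} {T : measurableType disp} {R : realType}.
Context (mu : {measure set T -> \bar R}) (D : set T).
Implicit Types f g : T -> R.

(** The working class of integrands: on a set of finite measure its members are integrable, and
    unlike integrable functions they are stable under products. *)
Definition bmeas f :=
  measurable_fun D f /\ exists M : R, forall x, D x -> `|f x| <= M.

Lemma bmeas_cst (c : R) : bmeas (fun=> c).
Proof. by split; [exact: measurable_cst|exists `|c|]. Qed.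

Lemma bmeasD f g : bmeas f -> bmeas g -> bmeas (fun x => f x + g x).
Proof.
move=> [mf [M fM]] [mg [N gN]]; split; first exact: measurable_funD.
by exists (M + N) => x Dx; rewrite (le_trans (ler_normD _ _))// lerD ?fM ?gN.
Qed.

Lemma bmeasM f g : bmeas f -> bmeas g -> bmeas (fun x => f x * g x).
Proof.
move=> [mf [M fM]] [mg [N gN]]; split; first exact: measurable_funM.
by exists (M * N) => x Dx; rewrite normrM ler_pM ?fM ?gN.
Qed.

Lemma bmeasZ (c : R) f : bmeas f -> bmeas (fun x => c * f x).
Proof. by move=> bf; apply: bmeasM => //; exact: bmeas_cst. Qed.

Lemma bmeasB f g : bmeas f -> bmeas g -> bmeas (fun x => f x - g x).
Proof.
move=> bf bg; rewrite (_ : (fun x => _) = (fun x => f x + -1 * g x)).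
  by apply: bmeasD => //; exact: bmeasZ.
by apply/funext => x; rewrite mulN1r.
Qed.

Lemma bmeas_sum (I : Type) (r : seq I) (F : I -> T -> R) :
  (forall i, bmeas (F i)) -> bmeas (fun x => \sum_(i <- r) F i x).
Proof.
move=> bF; elim: r => [|i r IH].
  by under eq_fun do rewrite big_nil; exact: bmeas_cst.
by under eq_fun do rewrite big_cons; exact: bmeasD.
Qed.

(** The values stay in the image of the compact interval [[-M, M]] under [phi], which is bounded.
    This covers the nonlinear terms in [psi_e]. *)
Lemma bmeas_comp (phi : R -> R) f : continuous phi -> bmeas f ->
  bmeas (fun x => phi (f x)).
Proof.
move=> cphi [mf [M fM]]; split.
  by apply: (measurableT_comp (f := phi)) => //; exact: continuous_measurable_fun.
have := @segment_compact R (- M) M.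
move=> /(continuous_compact (continuous_subspaceT cphi)) /compact_bounded.
move=> [N [_ /(_ (N + 1))]] H; exists (N + 1) => x Dx.
apply: H; first by rewrite ltrDl.
exists (f x) => //; rewrite /= in_itv /=.
by rewrite -ler_norml; exact: fM.
Qed.

Hypotheses (mD : measurable D) (muD : (mu D < +oo)%E).
Local Notation I f := (\int[mu]_(x in D) f x)%R.

Lemma bmeas_integrable f : bmeas f -> mu.-integrable D (EFin \o f).
Proof.
move=> [mf [M fM]]; apply: measurable_bounded_integrable => //.
exists M; split; first exact: num_real.
by move=> N MN x Dx; apply: (le_trans (fM _ Dx)); exact: ltW.
Qed.

Lemma bmeas_integral_linear (c : R) f g : bmeas f -> bmeas g ->
  I (fun x => c * f x + g x) = c * I f + I g.
Proof.
move=> bf bg; rewrite RintegralD ?RintegralZl//; try exact: bmeas_integrable.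
by apply: (bmeas_integrable (f := fun x => c * f x)); exact: bmeasZ.
Qed.

Lemma bmeas_integralZ (c : R) f : bmeas f -> I (fun x => c * f x) = c * I f.
Proof. by move=> bf; rewrite RintegralZl//; exact: bmeas_integrable. Qed.

Lemma bmeas_integralB f g : bmeas f -> bmeas g ->
  I (fun x => f x - g x) = I f - I g.
Proof. by move=> bf bg; rewrite RintegralB//; exact: bmeas_integrable. Qed.

Lemma bmeas_integral_le f g : bmeas f -> bmeas g ->
  (forall x, D x -> f x <= g x) -> I f <= I g.
Proof. by move=> bf bg; apply: le_Rintegral => //; exact: bmeas_integrable. Qed.

(** Compares [f] with [c] times the indicator of [A], whose integral is [c] times the measure of
    [A]. *)
Lemma bmeas_integral_gt0 f (A : set T) (c : R) : bmeas f ->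
  (forall x, D x -> 0 <= f x) -> measurable A -> A `<=` D -> (0 < mu A)%E ->
  0 < c -> (forall x, A x -> c <= f x) -> 0 < I f.
Proof.
move=> bf f0 mA AD muA c0 fc.
have muAoo : (mu A < +oo)%E by rewrite (le_lt_trans _ muD)// le_measure ?inE.
apply: (@lt_le_trans _ _ (c * fine (mu A))).
  by rewrite mulr_gt0// fine_gt0// muA.
have -> : c * fine (mu A) = I ((fun=> c) \_ A).
  rewrite -Rintegral_cst// Rintegral_mkcond [RHS]Rintegral_mkcond.
  apply: eq_Rintegral => x _; rewrite !patchE; case: ifPn => xA.
    by rewrite ifT// inE; apply: AD; move: xA; rewrite inE.
  by case: ifP.
apply: bmeas_integral_le => //.
  rewrite (_ : _ \_ A = fun x => c * \1_A x).
    apply: bmeasZ; split; first exact: measurable_indic.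
    by exists 1 => x _; rewrite indicE; case: (_ \in _); rewrite ?normr0 ?normr1.
  by apply/funext => x; rewrite patchE indicE; case: ifP => _; rewrite ?mulr1 ?mulr0.
move=> x Dx; rewrite patchE; case: ifPn => [|_]; last exact: f0.
by rewrite inE => /fc.
Qed.

End bounded_measurable.

(** The image is an interval; two distinct values would give it a segment of positive length,
    whereas finite sets are Lebesgue null. Meant for functions that are constant on each of finitely
    many cells. *)
Lemma connected_finite_image_cst {R : realType} (X : topologicalType)
    (A : set X) (f : X -> R) : connected A -> {within A, continuous f} ->
  finite_set (f @` A) -> forall x y, A x -> A y -> f x = f y.
Proof.
move=> cA cf finf.
suff lt_false x y : A x -> A y -> f x < f y -> False.
  move=> x y Ax Ay; case: (ltgtP (f x) (f y)) => // fxy.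
    by case: (lt_false x y).
  by case: (lt_false y x).
move=> Ax Ay fxy.
have /connected_intervalP itvf := connected_continuous_connected cA cf.
have sub : `[f x, f y]%classic `<=` f @` A.
  by move=> z; rewrite /= in_itv /=; apply: itvf; [exists x|exists y].
have := countable_lebesgue_measure0 (finite_set_countable (sub_finite_set sub finf)).
rewrite lebesgue_measure_itv /= lte_fin fxy -EFinB => -[] /eqP.
by rewrite subr_eq0 gt_eqF.
Qed.

(** * Algebra of the Frobenius and tensor products *)

Section frob.
Context {R : realType}.

Lemma frobC p q (A B : 'M[R]_(p, q)) : frob A B = frob B A.
Proof. by apply: eq_bigr => i _; apply: eq_bigr => j _; rewrite mulrC. Qed.

Lemma frob_linear p q (c : R) (A B C : 'M[R]_(p, q)) :
  frob (c *: A + B) C = c * frob A C + frob B C.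
Proof.
rewrite /frob big_distrr -big_split; apply: eq_bigr => i _ /=.
rewrite big_distrr -big_split; apply: eq_bigr => j _ /=.
by rewrite !mxE mulrDl mulrA.
Qed.

Lemma frobZl p q (c : R) (A C : 'M[R]_(p, q)) : frob (c *: A) C = c * frob A C.
Proof.
rewrite /frob big_distrr; apply: eq_bigr => i _ /=.
by rewrite big_distrr; apply: eq_bigr => j _ /=; rewrite !mxE mulrA.
Qed.

Lemma frobDl p q (A B C : 'M[R]_(p, q)) : frob (A + B) C = frob A C + frob B C.
Proof. by rewrite -[A]scale1r frob_linear mul1r scale1r. Qed.

Lemma frob_ge0 p q (A : 'M[R]_(p, q)) : 0 <= frob A A.
Proof. by apply: sumr_ge0 => i _; apply: sumr_ge0 => j _; rewrite -expr2 sqr_ge0. Qed.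

Lemma frob_ge_entry p q (A : 'M[R]_(p, q)) i j : A i j ^+ 2 <= frob A A.
Proof.
rewrite /frob (bigD1 i)//= (bigD1 j)//= -expr2 -addrA lerDl addr_ge0//.
  by apply: sumr_ge0 => k _; rewrite -expr2 sqr_ge0.
by apply: sumr_ge0 => k _; apply: sumr_ge0 => l _; rewrite -expr2 sqr_ge0.
Qed.

Lemma enorm_sqr p q (A : 'M[R]_(p, q)) : enorm A ^+ 2 = frob A A.
Proof. by rewrite /enorm sqr_sqrtr// frob_ge0. Qed.

Lemma frob_sumr p n (a : 'rV[R]_p) (lam : 'I_n -> R) (x : 'I_n -> 'rV[R]_p) :
  frob a (\sum_i lam i *: x i) = \sum_i lam i * frob a (x i).
Proof.
rewrite frobC; elim/big_ind2 : _ => [|x1 x2 y1 y2 <- <-|i _].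
- by rewrite /frob big1// => i _; rewrite big1// => j _; rewrite mxE mul0r.
- exact: frobDl.
- by rewrite frobZl frobC.
Qed.

Lemma frob_delta p (a : 'rV[R]_p) j : frob a (delta_mx ord0 j) = a ord0 j.
Proof.
rewrite /frob big_ord1 (bigD1 j)//= mxE !eqxx mulr1 big1 ?addr0// => k kj.
by rewrite mxE (negbTE kj) andbF mulr0.
Qed.

Lemma tensor_linearl p q (c : R) (a b : 'rV[R]_p) (e : 'rV[R]_q) :
  tensor (c *: a + b) e = c *: tensor a e + tensor b e.
Proof. by apply/matrixP => i j; rewrite !mxE mulrDl mulrA. Qed.

Lemma tensor_linearr p q (c : R) (e : 'rV[R]_p) (a b : 'rV[R]_q) :
  tensor e (c *: a + b) = c *: tensor e a + tensor e b.
Proof. by apply/matrixP => i j; rewrite !mxE mulrDr mulrCA. Qed.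

Lemma derive_affine p (a x : 'rV[R]_p) (b : R) j :
  'D_(delta_mx ord0 j) (fun y => frob a y + b) x = a ord0 j.
Proof.
rewrite /derive; apply: lim_near_cst => //; near=> h.
have h0 : h != 0 by near: h; exact: nbhs_dnbhs_neq.
rewrite /= frobC frobDl frobZl ![frob _ a]frobC frob_delta.
rewrite (_ : _ - _ = h * a ord0 j); last by ring.
by rewrite /GRing.scale /= mulKf.
Unshelve. all: by end_near. Qed.

End frob.

(** * Finite element functions *)

Section finite_elements.
Context {R : realType} {d : nat} (P : problem R d).
Local Notation E := 'rV[R]_d.
Local Notation T := (Th P).
Local Notation nd := (@node R d P).
Local Notation mu := (@lebesgue_rV R d).
Implicit Types (K : {set 'I_(nvert T)}) (u v w s : E -> R) (m n t phi : E -> E).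

(** The interface between the geometry and the analysis. [cell_interior] states that the elements
    are nondegenerate; it comes from the inscribed balls of shape regularity. *)
Record mesh_hyp : Prop := MeshHyp {
  open_Omega : open (Omega P);
  connected_Omega : connected (Omega P);
  nonempty_Omega : Omega P !=set0;
  bounded_Omega : bounded_set (Omega P);
  vert_in_elem : forall z, exists2 K, K \in elems T & z \in K;
  cover_Omega : closure (Omega P) = \bigcup_(K in [set` elems T]) cell K;
  cell_interior : forall K, K \in elems T -> (cell K)^° !=set0 }.

Hypothesis meshP : mesh_hyp.

Lemma measurable_Omega : measurable (Omega P).
Proof. exact: open_rV_measurable (open_Omega meshP). Qed.

Lemma Omega_lty : (mu (Omega P) < +oo)%E.
Proof. by apply: lebesgue_rV_bounded_lty (bounded_Omega meshP); exact: measurable_Omega. Qed.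

Lemma cell_closure K : K \in elems T -> cell K `<=` closure (Omega P).
Proof. by move=> KT x Kx; rewrite (cover_Omega meshP); exists K. Qed.

Lemma cell_node K z : z \in K -> cell K (nd z).
Proof.
move=> zK; exists (fun i => (i == z)%:R); split.
- by move=> i; rewrite ler0n.
- by move=> i iK; case: eqP iK => // ->; rewrite zK.
- by rewrite (bigD1 z)//= eqxx big1 ?addr0// => i /negbTE ->.
- rewrite (bigD1 z)//= eqxx scale1r big1 ?addr0// => i /negbTE ->.
  by rewrite scale0r.
Qed.

(** The weights are the barycentric coordinates of [x] in [K]. Those of vertices outside [K] are 0,
    so the sum may run over all vertices although [v] is affine on [K] only. *)
Lemma Vh_nodal v K x : Vh P v -> K \in elems T -> cell K x ->
  exists lam : 'I_(nvert T) -> R,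
    [/\ forall i, 0 <= lam i, \sum_i lam i = 1 &
        v x = \sum_i lam i * v (nd i)].
Proof.
move=> [_ va _] KT [lam [lam0 lamK lam1 xE]]; exists lam; split => //.
have [a [b vE]] := va K KT.
rewrite vE; last by exists lam.
rewrite xE frob_sumr -[b]mul1r -lam1 big_distrl -big_split /=.
apply: eq_bigr => i _; have [iK|/lamK ->] := boolP (i \in K).
  by rewrite vE ?mulrDr//; exact: cell_node.
by rewrite !mul0r addr0.
Qed.

Lemma Vh_eq0 v : Vh P v -> (forall z : 'I_(nvert T), v (nd z) = 0) -> v = 0.
Proof.
move=> Vv v0; apply/funext => x; have [/=|nx] := pselect (closure (Omega P) x).
  rewrite (cover_Omega meshP) => -[K KT Kx].
  have [lam [_ _ ->]] := Vh_nodal Vv KT Kx.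
  by rewrite big1// => i _; rewrite v0 mulr0.
by have [_ _ ->] := Vv.
Qed.

Lemma Vh_bounded v : Vh P v -> exists M : R, forall x, `|v x| <= M.
Proof.
move=> Vv; exists (\sum_(i : 'I_(nvert T)) `|v (nd i)|) => x.
have [/=|nx] := pselect (closure (Omega P) x); last first.
  by have [_ _ ->//] := Vv; rewrite normr0 sumr_ge0.
rewrite (cover_Omega meshP) => -[K KT Kx].
have [lam [lam0 lam1 ->]] := Vh_nodal Vv KT Kx.
rewrite (le_trans (ler_norm_sum _ _ _))//; apply: ler_sum => i _.
rewrite normrM ger0_norm// ler_piMl// -lam1 (bigD1 i)//= lerDl.
by apply: sumr_ge0.
Qed.

Lemma Vh_continuous v x : Vh P v -> Omega P x -> {for x, continuous v}.
Proof.
move=> [cv _ _] Ox; have := continuous_subspaceW (@subset_closure _ (Omega P)) cv.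
by rewrite (continuous_open_subspace _ (open_Omega meshP)); apply; rewrite inE.
Qed.

Lemma Vh_bmeas v : Vh P v -> bmeas (Omega P) v.
Proof.
move=> Vv; split; last by have [M vM] := Vh_bounded Vv; exists M => x _.
(* Open intervals generate the Borel sets, and their preimages within the open set Omega are
   open. *)
move=> mO; apply: (measurability _ (RGenOpens.measurableE R)) => //.
move=> _ [_ [a [b ->] <-]].
apply: open_rV_measurable; rewrite openE => x [Ox vx].
rewrite /interior; apply: filterI; first exact: open_nbhs_nbhs (conj (open_Omega meshP) Ox).
apply: (Vh_continuous Vv Ox); apply: open_nbhs_nbhs; split => //.

Qed.

Lemma Vh_subspace : subspace_of (Vh P).
Proof.
split.
  split => //; first by move=> x; exact: cst_continuous.
  move=> K _; exists 0, 0 => x _; rewrite addr0.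
  by rewrite /frob big1// => i _; rewrite big1// => j _; rewrite mxE mul0r.
move=> c u v [cu ua u0] [cv va v0]; split.
- apply: (@within_continuousD _ _ _ _ (c *: u) v) => // x.
  by apply: cvgZr; exact: cu.
- move=> K KT; have [a [b uE]] := ua K KT; have [a' [b' vE]] := va K KT.
  exists (c *: a + a'), (c * b + b') => x Kx.
  rewrite !fctE uE// vE// frob_linear /GRing.scale /=; ring.
- by move=> x nx; rewrite !fctE u0// v0// addr0 scaler0.
Qed.

Lemma VhD_subspace : subspace_of (VhD P).
Proof.
split; first by split; [have [] := Vh_subspace|].
move=> c u v [Vu u0] [Vv v0]; split; first by apply: Vh_subspace.2.
by move=> z Gz; rewrite !fctE u0// v0// addr0 scaler0.
Qed.

Lemma comp_linear (c : R) m n j : (fun x => (c *: m + n) x ord0 j) =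
  c *: (fun x => m x ord0 j) + (fun x => n x ord0 j).
Proof. by apply/funext => x; rewrite !fctE !mxE. Qed.

Lemma subspace_comp (X : set (E -> R)) : subspace_of X ->
  subspace_of [set v : E -> E | forall j, X (fun x => v x ord0 j)].
Proof.
move=> [X0 XD]; split.
  move=> j /=; rewrite (_ : (fun x => _) = 0)//.
  by apply/funext => x; exact: mxE.
by move=> c m n Xm Xn j; rewrite comp_linear; exact: XD.
Qed.

Lemma Vhd_subspace : subspace_of (Vhd P).
Proof. exact/subspace_comp/Vh_subspace. Qed.

Lemma Kh_subspace n : subspace_of (Kh P n).
Proof.
have [V0 VD] : subspace_of (VhDd P) by exact/subspace_comp/VhD_subspace.
split.
  split => // z; rewrite /frob big1// => i _; rewrite big1// => j _.
  by rewrite [X in _ * X](_ : _ = 0) ?mulr0//; exact: mxE.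
move=> c t phi [Vt t0] [Vp p0]; split; first exact: VD.
by move=> z; rewrite frobC frob_linear ![frob _ (n _)]frobC t0 p0 mulr0 addr0.
Qed.

Lemma Kh_Vhd n t : Kh P n t -> Vhd P t.
Proof. by move=> [Vt _] j; have [] := Vt j. Qed.

Lemma grad_affine v K (a : E) (b : R) x : K \in elems T ->
  (forall y, cell K y -> v y = frob a y + b) -> (cell K)^° x -> grad P v x = a.
Proof.
move=> KT vE Kx; apply/rowP => j; rewrite mxE.
rewrite ifT; last by rewrite inE; exists K.
rewrite (near_eq_derive (g := fun y => frob a y + b)) ?derive_affine//.
by apply: filterS Kx => y; exact: vE.
Qed.

Lemma grad_outside v x : ~ inside_elem P x -> grad P v x = 0.
Proof.
by move=> nx; apply/rowP => j; rewrite !mxE ifF//; apply/negbTE; rewrite notin_setE.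
Qed.

(** Holds at every point: inside an element both functions are affine, and on the skeleton the
    default value 0 is linear as well. *)
Lemma grad_linear (c : R) u v x : Vh P u -> Vh P v ->
  grad P (c *: u + v) x = c *: grad P u x + grad P v x.
Proof.
move=> [_ ua _] [_ va _].
have [[K KT Kx]|nx] := pselect (inside_elem P x); last first.
  by rewrite !grad_outside// scaler0 addr0.
have [a [b uE]] := ua K KT; have [a' [b' vE]] := va K KT.
rewrite (grad_affine KT uE Kx) (grad_affine KT vE Kx).
apply: (grad_affine (b := c * b + b') KT _ Kx) => y Ky.
rewrite !fctE uE// vE// frob_linear /GRing.scale /=; ring.
Qed.

(** A step function: it equals the constant [a K] in the interior of each of the finitely many
    elements, and 0 elsewhere. *)
Lemma grad_bmeas v j : Vh P v -> bmeas (Omega P) (fun x => grad P v x ord0 j).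
Proof.
move=> [_ va _].
have /choice[a aP] (K : {set 'I_(nvert T)}) : exists a : E, K \in elems T ->
    forall x, (cell K)^° x -> grad P v x = a.
  have [KT|] := boolP (K \in elems T); last by exists 0.
  have [a [b vE]] := va K KT; exists a => _ x Kx; exact: (grad_affine KT vE Kx).
split; last first.
  exists (\sum_(K in elems T) `|a K ord0 j|) => x _.
  have [[K KT Kx]|nx] := pselect (inside_elem P x); last first.
    by rewrite grad_outside// mxE normr0; exact: sumr_ge0.
  by rewrite (aP K)// (bigD1 K)//= lerDl; exact: sumr_ge0.
move=> mO Y mY.
have -> : Omega P `&` (fun x => grad P v x ord0 j) @^-1` Y =
  Omega P `&` (\bigcup_(K in [set K | K \in elems T /\ Y (a K ord0 j)]) (cell K)^°
    `|` ~` inside_elem P `&` [set x | Y 0]).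
  apply/seteqP; split => x [Ox].
    move=> /= Yx; split => //; have [[K KT Kx]|nx] := pselect (inside_elem P x).
      by left; exists K => //=; split => //; rewrite -(aP K KT x Kx).
    by right; split => //; move: Yx; rewrite grad_outside// mxE.
  move=> [[K [KT YK] Kx]|[nx Y0]]; split => //=; first by rewrite (aP K KT x Kx).
  by rewrite grad_outside// mxE.
apply: measurableI => //; apply: measurableU.
  apply: fin_bigcup_measurable => // K _; apply: open_rV_measurable.
  exact: open_interior.
apply: measurableI.
  apply: measurableC; apply: fin_bigcup_measurable => // K _.
  by apply: open_rV_measurable; exact: open_interior.
by have [Y0|nY0] := pselect (Y 0); [rewrite (_ : [set _ | _] = setT)|
   rewrite (_ : [set _ | _] = set0)] => //; apply/seteqP; split.
Qed.

(** The gradient is constant inside an element, so one zero per element makes [v] constant on every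
    cell. Connectedness of the closure then replaces any chain of neighbouring elements. *)
Lemma grad0_cst v x y : Vh P v ->
  (forall K, K \in elems T -> exists2 z, (cell K)^° z & grad P v z = 0) ->
  closure (Omega P) x -> closure (Omega P) y -> v x = v y.
Proof.
move=> [cv va _] g0; apply: (connected_finite_image_cst _ cv).
  exact: connected_closure (connected_Omega meshP).
have /choice[b bP] (K : {set 'I_(nvert T)}) : exists b : R, K \in elems T ->
    forall x, cell K x -> v x = b.
  have [KT|] := boolP (K \in elems T); last by exists 0.
  have [a [b vE]] := va K KT; exists b => _ z Kz.
  have [z0 Kz0] := g0 K KT; rewrite (grad_affine KT vE Kz0) => a0.
  rewrite vE// a0 /frob big1 ?add0r// => i _; rewrite big1// => j _.
  by rewrite mxE mul0r.
apply: (@sub_finite_set _ _ (b @` [set: {set 'I_(nvert T)}])); last first.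
  exact: finite_image.
move=> _ [z + <-]; rewrite (cover_Omega meshP) => -[K KT Kz].
by exists K => //; rewrite (bP K KT z Kz).
Qed.

End finite_elements.

(** * The Dirichlet form *)

Section forms.
Context {R : realType} {d : nat} (P : problem R d).
Local Notation E := 'rV[R]_d.
Local Notation T := (Th P).
Local Notation nd := (@node R d P).
Local Notation mu := (@lebesgue_rV R d).
Implicit Types (u v w s : E -> R) (m n t phi : E -> E).

Hypothesis meshP : mesh_hyp P.
Let mO := measurable_Omega meshP.
Let Ooo := Omega_lty meshP.

Definition mxbmeas p q (F : E -> 'M[R]_(p, q)) :=
  forall i j, bmeas (Omega P) (fun x => F x i j).

Lemma frob_bmeas p q (F G : E -> 'M[R]_(p, q)) : mxbmeas F -> mxbmeas G ->
  bmeas (Omega P) (fun x => frob (F x) (G x)).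
Proof.
by move=> bF bG; apply: bmeas_sum => i; apply: bmeas_sum => j; exact: bmeasM.
Qed.

Lemma ipC p q (F G : E -> 'M[R]_(p, q)) : ip P F G = ip P G F.
Proof. by rewrite /ip; under eq_fun do rewrite frobC. Qed.

Lemma ip_linear p q (c : R) (F G K : E -> 'M[R]_(p, q)) :
  mxbmeas F -> mxbmeas G -> mxbmeas K ->
  ip P (fun x => c *: F x + G x) K = c * ip P F K + ip P G K.
Proof.
move=> bF bG bK; rewrite /ip; under eq_fun do rewrite frob_linear.
by apply: bmeas_integral_linear => //; exact: frob_bmeas.
Qed.

Lemma ip_ge0 p q (F : E -> 'M[R]_(p, q)) : 0 <= ip P F F.
Proof. by apply: Rintegral_ge0 => x _; exact: frob_ge0. Qed.

Lemma ip_gt0 p q (F : E -> 'M[R]_(p, q)) (U : set E) (c : R) i j :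
  mxbmeas F -> open U -> U !=set0 -> U `<=` Omega P -> 0 < c ->
  (forall x, U x -> c <= F x i j ^+ 2) -> 0 < ip P F F.
Proof.
move=> bF oU U0 UO c0 cF.
apply: (bmeas_integral_gt0 mO Ooo (frob_bmeas bF bF) _ _ UO _ c0).
- by move=> x _; exact: frob_ge0.
- exact: open_rV_measurable.
- exact: lebesgue_rV_open_gt0.
- by move=> x Ux; exact: le_trans (cF x Ux) (frob_ge_entry _ _ _).
Qed.

Lemma Vhd_bmeas n : Vhd P n -> mxbmeas n.
Proof. by move=> Vn i j; rewrite (ord1 i); exact: Vh_bmeas (Vn j). Qed.

Lemma gradd_bmeas n : Vhd P n -> mxbmeas (gradd P n).
Proof.
by move=> Vn i j; under eq_fun do rewrite mxE; exact: grad_bmeas (Vn i).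
Qed.

Lemma tens_grad_bmeas n s : Vhd P n -> Vh P s -> mxbmeas (tens_grad P n s).
Proof.
move=> Vn Vs i j; under eq_fun do rewrite mxE.
by apply: bmeasM; [exact: Vh_bmeas (Vn i)|exact: grad_bmeas].
Qed.

Lemma scaled_grad_bmeas s n : Vh P s -> Vhd P n -> mxbmeas (scaled_grad P s n).
Proof.
move=> Vs Vn i j; under eq_fun do rewrite mxE.
by apply: bmeasM; [exact: Vh_bmeas Vs|exact: gradd_bmeas].
Qed.

Lemma gradd_linear (c : R) m n : Vhd P m -> Vhd P n ->
  gradd P (c *: m + n) = (fun x => c *: gradd P m x + gradd P n x).
Proof.
move=> Vm Vn; apply/funext => x; apply/matrixP => i j.
by rewrite [LHS]mxE comp_linear grad_linear// !mxE.
Qed.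

Lemma tens_grad_linearl (c : R) m n s :
  tens_grad P (c *: m + n) s =
  (fun x => c *: tens_grad P m s x + tens_grad P n s x).
Proof. by apply/funext => x; exact: tensor_linearl. Qed.

Lemma tens_grad_linearr (c : R) n u v : Vh P u -> Vh P v ->
  tens_grad P n (c *: u + v) =
  (fun x => c *: tens_grad P n u x + tens_grad P n v x).
Proof.
move=> Vu Vv; apply/funext => x.
by rewrite /tens_grad grad_linear//; exact: tensor_linearr.
Qed.

Lemma scaled_grad_linearl (c : R) u v n :
  scaled_grad P (c *: u + v) n =
  (fun x => c *: scaled_grad P u n x + scaled_grad P v n x).
Proof. by apply/funext => x; rewrite /scaled_grad scalerDl scalerA. Qed.

Lemma scaled_grad_linearr (c : R) s m n : Vhd P m -> Vhd P n ->
  scaled_grad P s (c *: m + n) =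
  (fun x => c *: scaled_grad P s m x + scaled_grad P s n x).
Proof.
move=> Vm Vn; apply/funext => x.
by rewrite /scaled_grad gradd_linear// scalerDr !scalerA mulrC.
Qed.

(* The symmetric form with E_1^h[s, n] = dirichlet s n s n / 2; the two steps
   of the algorithm use it with s, respectively n, frozen. *)
Definition dirichlet s n s' n' :=
  kappa P * ip P (tens_grad P n s) (tens_grad P n' s') +
  ip P (scaled_grad P s n) (scaled_grad P s' n').

Lemma dirichletC s n s' n' : dirichlet s n s' n' = dirichlet s' n' s n.
Proof. by rewrite /dirichlet (ipC (tens_grad P n s)) (ipC (scaled_grad P s n)). Qed.

Lemma dirichlet_linear_n s s' n' : Vh P s -> Vh P s' -> Vhd P n' ->
  linear_on (Vhd P) (fun n => dirichlet s n s' n').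
Proof.
move=> Vs Vs' Vn' c m n Vm Vn.
rewrite /dirichlet tens_grad_linearl (scaled_grad_linearr c s Vm Vn).
rewrite (ip_linear c (tens_grad_bmeas Vm Vs) (tens_grad_bmeas Vn Vs)
  (tens_grad_bmeas Vn' Vs')).
rewrite (ip_linear c (scaled_grad_bmeas Vs Vm) (scaled_grad_bmeas Vs Vn)
  (scaled_grad_bmeas Vs' Vn')).
by do ?[move: (ip P _ _) => ?]; ring.
Qed.

Lemma dirichlet_linear_s n s' n' : Vhd P n -> Vh P s' -> Vhd P n' ->
  linear_on (Vh P) (fun s => dirichlet s n s' n').
Proof.
move=> Vn Vs' Vn' c u v Vu Vv.
rewrite /dirichlet scaled_grad_linearl (tens_grad_linearr c n Vu Vv).
rewrite (ip_linear c (tens_grad_bmeas Vn Vu) (tens_grad_bmeas Vn Vv)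
  (tens_grad_bmeas Vn' Vs')).
rewrite (ip_linear c (scaled_grad_bmeas Vu Vn) (scaled_grad_bmeas Vv Vn)
  (scaled_grad_bmeas Vs' Vn')).
by do ?[move: (ip P _ _) => ?]; ring.
Qed.

Lemma E1E s n : Vh P s -> Vhd P n -> E1 P s n = 2^-1 * dirichlet s n s n.
Proof.
move=> Vs Vn; rewrite /E1 /dirichlet; congr (_ * _).
rewrite -bmeas_integral_linear//; last first.
- by apply: frob_bmeas; exact: scaled_grad_bmeas.
- by apply: frob_bmeas; exact: tens_grad_bmeas.
congr integral_Omega; apply/funext => x.
by rewrite !enorm_sqr /scaled_grad frobZl frobC frobZl mulrA -expr2.
Qed.

Lemma dirichlet_ge0 s n : 0 <= kappa P -> 0 <= dirichlet s n s n.
Proof. by move=> k0; rewrite addr_ge0 ?ip_ge0// mulr_ge0 ?ip_ge0. Qed.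

(** The zero extension excludes a nonzero value off the closure, and continuity moves one on the
    boundary to a nearby point of Omega. *)
Lemma Vh_neq0 v : Vh P v -> v != 0 -> exists2 x, Omega P x & v x != 0.
Proof.
move=> Vv /eqP v0; apply: contrapT => nex; apply: v0; apply/funext => x.
have vO y : Omega P y -> v y = 0.
  by move=> Oy; apply/eqP/negPn/negP => vy; apply: nex; exists y.
have [cv _ vout] := Vv.
have [clx|/vout//] := pselect (closure (Omega P) x).
apply/eqP/negPn/negP => vx.
have /subspace_continuousP/(_ x clx) cvx := cv.
have /cvx : nbhs (v x) [set y : R | y != 0].
  by apply: open_nbhs_nbhs; split => //; exact: open_neq.
rewrite nbhs_simpl /= => /clx [y [Oy]] /(_ (subset_closure Oy)) /eqP.
by apply; exact: vO.
Qed.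

(** Near a point where [v] is nonzero, its square stays above half its value there. *)
Lemma Vh_ge_open v : Vh P v -> v != 0 -> exists (U : set E) (c : R),
  [/\ open U, U !=set0, U `<=` Omega P, 0 < c & forall x, U x -> c <= v x ^+ 2].
Proof.
move=> Vv /(Vh_neq0 Vv)[x Ox vx].
have v2 : 0 < v x ^+ 2 by rewrite exprn_even_gt0.
have nx : nbhs x [set y | v x ^+ 2 / 2 < v y ^+ 2].
  have cv2 : {for x, continuous (fun y => v y ^+ 2)}.
    apply: (@continuous_comp _ _ _ v (fun y => y ^+ 2)); last exact: exprn_continuous.
    exact: (Vh_continuous meshP Vv Ox).
  apply: (cvgr_gt _ cv2).
  by rewrite ltr_pdivrMr// ltr_pMr// ltr1n.
exists (Omega P `&` [set y | v x ^+ 2 / 2 < v y ^+ 2]^°), (v x ^+ 2 / 2).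
split.
- by apply: openI; [exact: open_Omega meshP|exact: open_interior].
- by exists x.
- by move=> y [].
- by rewrite divr_gt0.
- by move=> y [_ /interior_subset /= /ltW].
Qed.

(** If every component had a zero gradient somewhere in each element, all components would be
    constant, equal to their value 0 at the node [z]. So some component has a nonzero constant
    gradient [a] on some element. *)
Lemma gradd_definite phi : Vhd P phi -> phi != 0 ->
  (exists z, forall j, phi (nd z) ord0 j = 0) ->
  0 < ip P (gradd P phi) (gradd P phi).
Proof.
move=> Vp /eqP p0 [z zP].
suff [i [K [KT Ki]]] : exists i (K : {set 'I_(nvert T)}), K \in elems T /\
    forall y, (cell K)^° y -> grad P (fun x => phi x ord0 i) y != 0.
  have [_ va _] := Vp i; have [a [b vE]] := va K KT.
  have [y Ky] := cell_interior meshP KT.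
  have gE x := grad_affine KT vE (x := x).
  have := Ki y Ky; rewrite gE// => /rV0Pn[j aj].
  apply: (@ip_gt0 _ _ _ (Omega P `&` (cell K)^°) (a ord0 j ^+ 2) i j).
  - exact: gradd_bmeas.
  - by apply: openI; [exact: open_Omega meshP|exact: open_interior].
  (* A cell is only known to lie in the closure of Omega; its interior, a neighbourhood of a point
     of that closure, still meets Omega. *)
  - have /(cell_closure meshP KT) := interior_subset Ky.
    move=> /(_ (cell K)^°) [|w [Ow Kw]]; last by exists w.
    exact: open_nbhs_nbhs (conj (open_interior _) Ky).
  - by move=> x [].
  - by rewrite exprn_even_gt0.
  - by move=> x [_ Kx]; rewrite mxE gE.
apply: contrapT => nex; apply: p0; apply/funext => x; apply/rowP => i.
rewrite [RHS]mxE.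
have [clx|nx] := pselect (closure (Omega P) x); last by have [_ _ ->] := Vp i.
have [K KT zK] := vert_in_elem meshP z.
have clz : closure (Omega P) (nd z).
  exact: (cell_closure meshP KT (cell_node zK)).
rewrite -(zP i); apply: (@grad0_cst _ _ _ meshP (fun x => phi x ord0 i)) => //.
move=> K' KT'; apply: contrapT => nK'; apply: nex; exists i, K'; split => // y Ky.
by apply/eqP => gy; apply: nK'; exists y.
Qed.

End forms.

(** * The metric of the flow *)

Section star_form.
Context {R : realType} {d : nat} (P : problem R d).
Local Notation E := 'rV[R]_d.
Local Notation T := (Th P).
Local Notation nd := (@node R d P).
Implicit Types (u v w s : E -> R) (m n t phi : E -> E).

Hypothesis meshP : mesh_hyp P.
Let mO := measurable_Omega meshP.
Let Ooo := Omega_lty meshP.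

Lemma ipZ p q (c : R) (F G : E -> 'M[R]_(p, q)) :
  mxbmeas P F -> mxbmeas P G -> ip P (fun x => c *: F x) G = c * ip P F G.
Proof.
move=> bF bG; rewrite /ip -(bmeas_integralZ mO Ooo); last exact: frob_bmeas.
by congr integral_Omega; apply/funext => x; rewrite frobZl.
Qed.

Lemma hull_bound k (p : 'I_k -> E) (S : {set 'I_k}) x j : hull p S x ->
  `|x ord0 j| <= \sum_i `|p i ord0 j|.
Proof.
move=> [lam [lam0 _ lam1 ->]]; rewrite summxE (le_trans (ler_norm_sum _ _ _))//.
apply: ler_sum => i _; rewrite mxE normrM ger0_norm// ler_piMl// -lam1.
by rewrite (bigD1 i)//= lerDl; exact: sumr_ge0.
Qed.

(** [mesh_size] applies [fine] to diameters, and [fine] sends infinity to 0, so finiteness is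
    required before the mesh size can be bounded below. *)
Lemma ediam_hull_lty k (p : 'I_k -> E) (S : {set 'I_k}) :
  (ediam (hull p S) < +oo)%E.
Proof.
pose B (j : 'I_d) : R := \sum_i `|p i ord0 j|.
have B0 j : 0 <= B j by exact: sumr_ge0.
pose C : R := \sum_j (B j + B j) ^+ 2.
apply: (@le_lt_trans _ _ (Num.sqrt C)%:E); last exact: ltry.
apply: ge_ereal_sup => _ [->|[[x y] [/= Sx Sy] <-]]; first by rewrite lee_fin sqrtr_ge0.
rewrite lee_fin /enorm ler_wsqrtr// /frob big_ord1; apply: ler_sum => j _.
have : `|(x - y) ord0 j| <= B j + B j.
  rewrite !mxE (le_trans (ler_normB _ _))// lerD//.
    exact: (hull_bound j Sx).
  exact: (hull_bound j Sy).
by rewrite ler_norml => /andP[]; nra.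
Qed.

(** Gives the weight [h^alpha] a positive value. Around an interior point [y] of an element there is
    room for a shift by [e / 2] along a coordinate axis, so the diameter is at least [e / 2]. *)
Lemma mesh_size_gt0 : (0 < d)%N -> 0 < mesh_size T.
Proof.
move=> d0; have [x Ox] := nonempty_Omega meshP.
have := subset_closure Ox; rewrite (cover_Omega meshP) => -[K KT _].
have [y Ky] := cell_interior meshP KT.
have /nbhs_ballP[e /= e0 eK] := Ky.
pose z : E := y + (e / 2) *: delta_mx ord0 (Ordinal d0).
have yz : ball y e z.
  split => // i j; rewrite (ord1 i) /z !mxE -ball_normE /=.
  rewrite opprD addrA subrr sub0r normrN normrM ger0_norm ?divr_ge0// ?ltW//.
  apply: (@le_lt_trans _ _ (e / 2)); last by rewrite ltr_pdivrMr// ltr_pMr// ltr1n.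
  apply: ler_piMr; first by rewrite divr_ge0// ltW.
  by case: (_ == _); rewrite ?normr0 ?normr1.
have zy : enorm (z - y) = e / 2.
  rewrite /z addrC addKr /enorm frobZl frobC frobZl frob_delta mxE !eqxx mulr1.
  by rewrite -expr2 sqrtr_sqr ger0_norm// divr_ge0// ltW.
have le_diam : ((e / 2)%:E <= ediam (cell K))%E.
  rewrite -zy; apply: ereal_sup_ubound; right; exists (z, y) => //.
  by split; [exact: eK|exact: interior_subset Ky].
have fin_diam : ediam (cell K) \is a fin_num.
  rewrite fin_real// (lt_le_trans _ le_diam) ?ltNyr//=; exact: ediam_hull_lty.
apply: (@lt_le_trans _ _ (e / 2)); first by rewrite divr_gt0.
apply: (@le_trans _ _ (fine (ediam (cell K)))).
  by rewrite -lee_fin fineK.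
by rewrite /mesh_size (bigD1 K)//= le_max lexx.
Qed.

Lemma ip_starE t phi : Vhd P t -> Vhd P phi ->
  ip_star P t phi = match star P with
  | L2_metric => ip P t phi
  | H1_metric alpha =>
      (mesh_size T `^ alpha) * ip P (gradd P t) (gradd P phi)
  end.
Proof.
move=> Vt Vp; rewrite /ip_star; case: star => // alpha.
by apply: ipZ; exact: gradd_bmeas.
Qed.

Lemma ip_star_linear phi : Vhd P phi ->
  linear_on (Vhd P) (fun t => ip_star P t phi).
Proof.
move=> Vp c m n Vm Vn.
have Vmn : Vhd P (c *: m + n) by exact: ((Vhd_subspace P).2 c m n Vm Vn).
rewrite !ip_starE//; case: star => [|alpha].
  exact: (ip_linear meshP c (Vhd_bmeas meshP Vm) (Vhd_bmeas meshP Vn)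
    (Vhd_bmeas meshP Vp)).
rewrite (gradd_linear c Vm Vn).
rewrite (ip_linear meshP c (gradd_bmeas Vm) (gradd_bmeas Vn)
  (gradd_bmeas Vp)).
by do ?[move: (ip P _ _) => ?]; ring.
Qed.

Lemma ip_starC t phi : Vhd P t -> Vhd P phi -> ip_star P t phi = ip_star P phi t.
Proof.
move=> Vt Vp; rewrite (ip_starE Vt Vp) (ip_starE Vp Vt).
by rewrite (ipC P t) (ipC P (gradd P t)).
Qed.

Lemma ip_star_ge0 phi : Vhd P phi -> 0 <= ip_star P phi phi.
Proof.
move=> Vp; rewrite ip_starE//; case: star => [|alpha]; first exact: ip_ge0.
by rewrite mulr_ge0 ?powR_ge0 ?ip_ge0.
Qed.

Lemma norm_star_sqr phi : Vhd P phi -> norm_star P phi ^+ 2 = ip_star P phi phi.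
Proof. by move=> Vp; rewrite /norm_star sqr_sqrtr// ip_star_ge0. Qed.

(** For the L2 metric a nonzero component suffices. For the H1 metric the constants must be
    excluded, which the node on [GammaD] supplied by [admissible_metric] does. *)
Lemma ip_star_gt0 phi : (0 < d)%N -> admissible_metric P -> VhDd P phi ->
  phi != 0 -> 0 < ip_star P phi phi.
Proof.
move=> d0 adm VDp p0; have Vp : Vhd P phi by move=> j; have [] := VDp j.
rewrite ip_starE//; move: adm; rewrite /admissible_metric.
case: star => [_|alpha [_ [z Gz]]].
  have [j pj] : exists j, (fun x => phi x ord0 j) != 0.
    apply: contrapT => nj; move/eqP: p0; apply; apply/funext => x.
    apply/rowP => j; rewrite [RHS]mxE; apply: contrapT => pxj; apply: nj.
    by exists j; apply/eqP => /(congr1 (fun f => f x)).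
  have [U [c [oU U0 UO c0 cU]]] := Vh_ge_open meshP (Vp j) pj.
  exact: (ip_gt0 meshP (Vhd_bmeas meshP Vp) oU U0 UO c0 cU).
rewrite mulr_gt0 ?powR_gt0 ?mesh_size_gt0//; apply: gradd_definite => //.
by exists z => j; have [_ ->] := VDp j.
Qed.

End star_form.

(** * The two steps of the algorithm *)

Section steps.
Context {R : realType} {d : nat} (P : problem R d).
Local Notation E := 'rV[R]_d.
Local Notation T := (Th P).
Local Notation nd := (@node R d P).
Implicit Types (u v w s : E -> R) (m n t phi : E -> E).

Hypothesis meshP : mesh_hyp P.
Hypotheses (d_gt0 : (0 < d)%N) (kappa_gt0 : 0 < kappa P).
Hypotheses (tau_n_gt0 : 0 < tau_n P) (tau_s_gt0 : 0 < tau_s P).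
Hypothesis adm : admissible_metric P.
Let mO := measurable_Omega meshP.
Let Ooo := Omega_lty meshP.

(** * The tangential update (G1) *)

Section G1_step.
Variables (s : E -> R) (n : E -> E).
Hypotheses (Vs : Vh P s) (Vn : Vhd P n).

Definition G1_form t phi := ip_star P t phi + tau_n P * dirichlet P s t s phi.

Lemma G1E t : G1 P s n t <->
  Kh P n t /\ forall phi, Kh P n phi -> G1_form t phi = - dirichlet P s n s phi.
Proof.
rewrite /G1 /G1_form /dirichlet; split=> -[Kt tP]; split => // phi /tP {tP}.
all: do ?[move: (ip P _ _) => ?]; move: (ip_star P _ _) => ?; lra.
Qed.

(** Definiteness rests on the metric: the Dirichlet part is only nonnegative, as [s] may vanish. *)
Lemma G1_form_spd : spd_on (Kh P n) G1_form.
Proof.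
split.
- move=> w /Kh_Vhd Vw c u v /Kh_Vhd Vu /Kh_Vhd Vv; rewrite /G1_form.
  have /= -> := ip_star_linear meshP Vw c Vu Vv.
  have /= -> := dirichlet_linear_n meshP Vs Vs Vw c Vu Vv.
  do ?[move: (ip_star P _ _) => ?]; do ?[move: (dirichlet P _ _ _ _) => ?].
  by ring.
- move=> u v /Kh_Vhd Vu /Kh_Vhd Vv; rewrite /G1_form.
  by rewrite (ip_starC meshP Vu Vv) (dirichletC P s u).
- move=> u [VDu _] u0; rewrite /G1_form ltr_pwDl//; first exact: ip_star_gt0.
  by apply: mulr_ge0; [|apply: dirichlet_ge0]; exact: ltW.
Qed.

Lemma G1_exists : exists t, G1 P s n t.
Proof.
have [[z j]|u Ku u0| | |t Kt tP] := @riesz_representation R _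
  ('I_(nvert T) * 'I_d)%type (enum predT)
  (fun zj (u : E -> E) => u (nd zj.1) ord0 zj.2) (Kh P n) G1_form
  (fun phi => - dirichlet P s n s phi) (Kh_subspace P n).
- by move=> c u v _ _; rewrite /= !mxE.
- apply/funext => x; apply/rowP => j; rewrite [RHS]mxE.
  have Vu := Kh_Vhd Ku j.
  have /(congr1 (fun f => f x)) : (fun x => u x ord0 j) = 0.
    by apply: (Vh_eq0 meshP Vu) => z; apply: (u0 (z, j)); rewrite mem_enum.
  exact.
- exact: G1_form_spd.
- move=> c u v /Kh_Vhd Vu /Kh_Vhd Vv; rewrite !(dirichletC P s n).
  have /= -> := dirichlet_linear_n meshP Vs Vs Vn c Vu Vv.
  by do ?[move: (dirichlet P _ _ _ _) => ?]; ring.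
- by exists t; apply/G1E.
Qed.

Lemma G1_unique t t' : G1 P s n t -> G1 P s n t' -> t = t'.
Proof.
move=> /G1E[Kt tP] /G1E[Kt' tP'].
exact: (riesz_representation_unique (Kh_subspace P n) G1_form_spd Kt tP Kt' tP').
Qed.

Lemma G1_update_Vhd t : G1 P s n t -> Vhd P (fun x => n x + tau_n P *: t x).
Proof.
move=> [/Kh_Vhd Vt _]; rewrite (_ : (fun x => _) = tau_n P *: t + n).
  exact: ((Vhd_subspace P).2 _ _ _ Vt Vn).
by apply/funext => x; rewrite addrC.
Qed.

(** With D the Dirichlet form for frozen [s], expanding gives the change
    [tau D(n,t) + tau^2/2 D(t,t)], and (G1) tested with [t] gives [D(n,t) = - |t|_*^2 - tau D(t,t)].
    Hence an equality, in which half of the implicit term survives as [tau^2 E1]. *)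
Lemma G1_energy t : G1 P s n t ->
  E1 P s (fun x => n x + tau_n P *: t x) - E1 P s n =
  - (tau_n P * norm_star P t ^+ 2) - tau_n P ^+ 2 * E1 P s t.
Proof.
move=> G; have Vn' := G1_update_Vhd G; move/G1E: G => [Kt /(_ t Kt)].
have Vt := Kh_Vhd Kt; rewrite /G1_form => Gt.
rewrite (norm_star_sqr meshP Vt) !(E1E meshP)//.
move: Vn'; rewrite (_ : (fun x => _) = tau_n P *: t + n); last first.
  by apply/funext => x; rewrite addrC.
move=> Vn'.
have /= -> := dirichlet_linear_n meshP Vs Vs Vn' (tau_n P) Vt Vn.
rewrite (dirichletC P s t) (dirichletC P s n s (_ + _)).
have /= -> := dirichlet_linear_n meshP Vs Vs Vt (tau_n P) Vt Vn.
have /= -> := dirichlet_linear_n meshP Vs Vs Vn (tau_n P) Vt Vn.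
rewrite (dirichletC P s t s n); move: Gt.
do ?[move: (ip_star P _ _) => ?]; do ?[move: (dirichlet P _ _ _ _) => ?].
by move=> /(canRL (addrK _)) ->; field.
Qed.

End G1_step.

(** Stated for bounded measurable functions because the derivatives of the potentials along [s] need
    not be finite element functions. *)
Lemma ips_linear (c : R) u v w : bmeas (Omega P) u -> bmeas (Omega P) v ->
  bmeas (Omega P) w ->
  ips P (fun x => c * u x + v x) w = c * ips P u w + ips P v w.
Proof.
move=> bu bv bw; rewrite /ips.
have := bmeas_integral_linear mO Ooo c (bmeasM bu bw) (bmeasM bv bw) => /= <-.
by congr integral_Omega; apply/funext => x; rewrite mulrDl mulrA.
Qed.

Lemma ipsC u v : ips P u v = ips P v u.
Proof. by congr integral_Omega; apply/funext => x; rewrite mulrC. Qed.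

Lemma ips_ge0 u : 0 <= ips P u u.
Proof. by apply: Rintegral_ge0 => x _; rewrite -expr2 sqr_ge0. Qed.

Lemma ips_gt0 v : Vh P v -> v != 0 -> 0 < ips P v v.
Proof.
move=> Vv v0; have [U [c [oU U0 UO c0 cU]]] := Vh_ge_open meshP Vv v0.
have bv := Vh_bmeas meshP Vv.
apply: (bmeas_integral_gt0 mO Ooo (bmeasM bv bv) _ _ UO _ c0).
- by move=> x _; rewrite -expr2 sqr_ge0.
- exact: open_rV_measurable.
- exact: lebesgue_rV_open_gt0.
- by move=> x Ux; rewrite -expr2; exact: cU.
Qed.

Lemma norm_L2_sqr u : norm_L2 P u ^+ 2 = ips P u u.
Proof. by rewrite /norm_L2 sqr_sqrtr// ips_ge0. Qed.

Lemma dtE s s' : dt P s s' = (tau_s P)^-1 *: (s' - s).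
Proof. by apply/funext => x; rewrite /dt mulrC. Qed.

(** * The update of the scalar field (G3) *)

Section G3_step.
Variables (s : E -> R) (n : E -> E) (a b c : R).
Hypotheses (Vs : Vh P s) (Vn : Vhd P n).
Hypothesis s_bc : forall z : 'I_(nvert T), GammaD P (nd z) -> s (nd z) = gh P (nd z).
Hypothesis psi_splitE : forall r, psi P r = psi_c P r - psi_e P r.
Hypotheses (convex_c : convexR (psi_c P)) (convex_e : convexR (psi_e P)).
Hypothesis psi_cE : forall r, psi_c P r = a * r ^+ 2 + b * r + c.
Hypotheses (derivable_e : forall r, derivable (psi_e P) r 1)
  (continuous_e' : continuous (derive1 (psi_e P))).

Let a_ge0 : 0 <= a.
Proof. exact: convexR_quadratic_ge0 convex_c psi_cE. Qed.

Let psi_c'E := derive1_quadratic psi_cE.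

Let force x := derive1 (psi_e P) (s x).

Let force_bmeas : bmeas (Omega P) force.
Proof. exact: (bmeas_comp continuous_e' (Vh_bmeas meshP Vs)). Qed.

Let psi_c'_bmeas u : Vh P u -> bmeas (Omega P) (fun x => derive1 (psi_c P) (u x)).
Proof.
move=> /(Vh_bmeas meshP) bu; rewrite psi_c'E.
by apply: bmeasD; [exact: bmeasZ|exact: bmeas_cst].
Qed.

(** The left side of (G3) in the increment [u]: [1/tau_s] stems from the time derivative, and [2 a]
    from [psi_c'(u + s) = 2 a u + psi_c'(s)]. What remains at [s] goes to [G3_load]. *)
Definition G3_form u w :=
  ((tau_s P)^-1 + 2 * a) * ips P u w + dirichlet P u n w n.

Definition G3_load w := ips P force w - ips P (fun x => derive1 (psi_c P) (s x)) w
  - dirichlet P s n w n.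

Lemma ips_linear_on w : Vh P w -> linear_on (Vh P) (fun u => ips P u w).
Proof. by move=> Vw k u v Vu Vv; apply: ips_linear; exact: Vh_bmeas. Qed.

Lemma G3E u : VhD P u -> G3 P s n (u + s) <->
  forall w, VhD P w -> G3_form u w = G3_load w.
Proof.
move=> VDu; have Vu := VDu.1.
have Vus : Vh P (u + s) by exact: subspaceD (Vh_subspace P) Vu Vs.
have dtu : dt P s (u + s) = (tau_s P)^-1 *: u by rewrite dtE addrK.
(* The residual of (G3) at [u + s] is the residual of the linear problem at [u], which yields both
   directions. *)
have key w : VhD P w -> ips P (dt P s (u + s)) w
      + kappa P * ip P (tens_grad P n (u + s)) (tens_grad P n w)
      + ip P (scaled_grad P (u + s) n) (scaled_grad P w n)
      + ips P (fun x => derive1 (psi_c P) ((u + s) x)) w - ips P force w =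
    G3_form u w - G3_load w.
  move=> [Vw _].
  have bu := Vh_bmeas meshP Vu; have bw := Vh_bmeas meshP Vw.
  have := linear_onD (dirichlet_linear_s meshP Vn Vw Vn) Vu Vs.
  have -> : ips P (dt P s (u + s)) w = (tau_s P)^-1 * ips P u w.
    by rewrite dtu; exact: (linear_onZ _ (Vh_subspace P).1 (ips_linear_on Vw) Vu).
  have -> : ips P (fun x => derive1 (psi_c P) ((u + s) x)) w =
      2 * a * ips P u w + ips P (fun x => derive1 (psi_c P) (s x)) w.
    rewrite -(ips_linear _ bu (psi_c'_bmeas Vs) bw); congr ips.
    by apply/funext => x; rewrite psi_c'E mulrDr addrA.
  rewrite /G3_form /G3_load /dirichlet.
  do ?[move: (ip P _ _) => ?]; do ?[move: (ips P _ _) => ?]; lra.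
split=> [[_ _ G] w VDw|G].
  by apply/eqP; rewrite -subr_eq0 -key// subr_eq0 G.
split => //.
  by move=> z Gz; rewrite fctE VDu.2// add0r s_bc.
by move=> w VDw; apply/eqP; rewrite -subr_eq0 key// G// subrr.
Qed.

(** Convexity of [psi_c] gives [0 <= a], so the coefficient of the L2 product is positive for every
    time step. *)
Lemma G3_form_spd : spd_on (VhD P) G3_form.
Proof.
split.
- move=> w [Vw _] k u v [Vu _] [Vv _]; rewrite /G3_form.
  rewrite (ips_linear_on Vw k Vu Vv).
  have /= -> := dirichlet_linear_s meshP Vn Vw Vn k Vu Vv.
  do ?[move: (ips P _ _) => ?]; do ?[move: (dirichlet P _ _ _ _) => ?].
  by ring.
- by move=> u v _ _; rewrite /G3_form (dirichletC P u) (ipsC u).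
- move=> u [Vu _] u0; rewrite /G3_form ltr_pwDl//.
    apply: mulr_gt0; last exact: ips_gt0.
    by rewrite ltr_pwDl ?invr_gt0// mulr_ge0.
  by apply: dirichlet_ge0; exact: ltW.
Qed.

Lemma G3_load_linear : linear_on (VhD P) G3_load.
Proof.
move=> k u v [Vu _] [Vv _]; rewrite /G3_load !(dirichletC P s n).
have /= -> := dirichlet_linear_s meshP Vn Vs Vn k Vu Vv.
rewrite !(ipsC _ (_ + _)).
have bu := Vh_bmeas meshP Vu; have bv := Vh_bmeas meshP Vv.
rewrite (ips_linear k bu bv force_bmeas) (ips_linear k bu bv (psi_c'_bmeas Vs)).
rewrite !(ipsC u) !(ipsC v).
do ?[move: (ips P _ _) => ?]; do ?[move: (dirichlet P _ _ _ _) => ?].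
by ring.
Qed.

Lemma G3_exists : exists s', G3 P s n s'.
Proof.
have [z|u Du u0| | |u Du uP] := @riesz_representation R _
  'I_(nvert T) (enum predT) (fun z (u : E -> R) => u (nd z)) (VhD P) G3_form
  G3_load (VhD_subspace P).
- by move=> k u v _ _; rewrite /= fctE.
- by apply: (Vh_eq0 meshP Du.1) => z; apply: u0; rewrite mem_enum.
- exact: G3_form_spd.
- exact: G3_load_linear.
- by exists (u + s); apply/(G3E Du).
Qed.

Lemma G3_increment s' : G3 P s n s' -> VhD P (s' - s).
Proof.
move=> [Vs' bc _]; split; first exact: (subspaceB (Vh_subspace P) Vs' Vs).
by move=> z Gz; rewrite -[LHS]/(s' (nd z) - s (nd z)) bc// s_bc// subrr.
Qed.

Lemma G3_unique s' s'' : G3 P s n s' -> G3 P s n s'' -> s' = s''.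
Proof.
move=> G G'; have D := G3_increment G; have D' := G3_increment G'.
rewrite -(subrK s s') -(subrK s s'') in G G' *; congr (_ + _).
move/(G3E D) : G => uP; move/(G3E D') : G' => uP'.
exact: (riesz_representation_unique (VhD_subspace P) G3_form_spd D uP D' uP').
Qed.

Let psi_c_bmeas u : Vh P u -> bmeas (Omega P) (fun x => psi_c P (u x)).
Proof.
move=> /(Vh_bmeas meshP) bu; under eq_fun do rewrite psi_cE.
by do ?apply: bmeasD; do ?apply: bmeasZ => //; [exact: bmeasM|exact: bmeas_cst].
Qed.

Let psi_e_bmeas u : Vh P u -> bmeas (Omega P) (fun x => psi_e P (u x)).
Proof.
move=> /(Vh_bmeas meshP); apply: bmeas_comp => r.
by apply: differentiable_continuous; exact/derivable1_diffP/derivable_e.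
Qed.

Lemma E2_convex_splitting s' : Vh P s' ->
  E2 P s' - E2 P s <=
  ips P (fun x => derive1 (psi_c P) (s' x)) (s' - s) - ips P force (s' - s).
Proof.
move=> Vs'; have Vd : Vh P (s' - s) by exact: (subspaceB (Vh_subspace P) Vs' Vs).
have bd := Vh_bmeas meshP Vd.
have bpsi u : Vh P u -> bmeas (Omega P) (fun x => psi P (u x)).
  move=> Vu; under eq_fun do rewrite psi_splitE.
  by apply: bmeasB; [exact: psi_c_bmeas|exact: psi_e_bmeas].
rewrite /E2 /ips /integral_Omega.
rewrite -(bmeas_integralB mO Ooo (bpsi s' Vs') (bpsi s Vs)).
rewrite -(bmeas_integralB mO Ooo (bmeasM (psi_c'_bmeas Vs') bd) (bmeasM force_bmeas bd)).
apply: (bmeas_integral_le mO Ooo).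
- by apply: bmeasB; exact: bpsi.
- by apply: bmeasB; apply: bmeasM => //; exact: psi_c'_bmeas.
move=> x _; rewrite !psi_splitE /force.
have -> : (s' - s) x = s' x - s x by [].
have dc : derivable (psi_c P) (s' x) 1.
  have -> : psi_c P = (fun r => a * r ^+ 2 + b * r + c) by exact/funext.
  exact: ex_derive.
have := convexR_tangent (s x) convex_c dc.
have := convexR_tangent (s' x) convex_e (@derivable_e (s x)).
lra.
Qed.

Lemma G3_energy s' : G3 P s n s' ->
  Eh P s' n - Eh P s n <=
  - (tau_s P * norm_L2 P (dt P s s') ^+ 2) - tau_s P ^+ 2 * E1 P (dt P s s') n.
Proof.
move=> G; have [Vs' _ /(_ _ (G3_increment G)) Gu] := G.
have Vu := (G3_increment G).1; have := E2_convex_splitting Vs'.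
have ts0 : tau_s P != 0 by rewrite gt_eqF.
have Ve : Vh P (dt P s s') by rewrite dtE; exact: (subspaceZ _ (Vh_subspace P) Vu).
have uE : s' - s = tau_s P *: dt P s s' by rewrite dtE scalerA divff// scale1r.
have e1 : ips P (dt P s s') (s' - s) = tau_s P * norm_L2 P (dt P s s') ^+ 2.
  rewrite norm_L2_sqr ipsC uE.
  exact: (linear_onZ _ (Vh_subspace P).1 (ips_linear_on Ve) Ve).
have e2 : dirichlet P (s' - s) n (s' - s) n =
    tau_s P ^+ 2 * dirichlet P (dt P s s') n (dt P s s') n.
  rewrite uE.
  have VtE : Vh P (tau_s P *: dt P s s') by rewrite -uE.
  rewrite (linear_onZ _ (Vh_subspace P).1 (dirichlet_linear_s meshP Vn VtE Vn) Ve).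
  rewrite dirichletC.
  rewrite (linear_onZ _ (Vh_subspace P).1 (dirichlet_linear_s meshP Vn Ve Vn) Ve).
  by rewrite mulrA expr2.
(* The polarization identity behind implicit Euler: testing with the increment yields the difference
   of energies plus the energy of the increment, which by [e2] is the term in [tau_s^2]. *)
have e3 : dirichlet P (s' - s) n (s' - s) n =
   2 * dirichlet P s' n (s' - s) n - dirichlet P s' n s' n + dirichlet P s n s n.
  rewrite (linear_onB (dirichlet_linear_s meshP Vn Vu Vn) Vs' Vs).
  rewrite !(dirichletC P _ n (s' - s) n).
  rewrite (linear_onB (dirichlet_linear_s meshP Vn Vs' Vn) Vs' Vs).
  rewrite (linear_onB (dirichlet_linear_s meshP Vn Vs Vn) Vs' Vs).
  rewrite (dirichletC P s' n s n).
  by do ?[move: (dirichlet P _ _ _ _) => ?]; ring.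
move: e1 e2 e3 Gu; rewrite /Eh !(E1E meshP)// /force.
rewrite /dirichlet; do ?[move: (ip P _ _) => ?]; do ?[move: (ips P _ _) => ?].
do ?[move: (E2 P _) => ?]; move: (norm_L2 P _ ^+ 2) (tau_s P ^+ 2) => ? ?.
lra.
Qed.

End G3_step.

End steps.

(** * The inner loop *)

Section inner_iteration.
Context {R : realType} {d : nat} (P : problem R d).
Local Notation E := 'rV[R]_d.
Implicit Types (s : E -> R) (n : E -> E) (nn t : nat -> E -> E).

Hypothesis meshP : mesh_hyp P.
Hypotheses (d_gt0 : (0 < d)%N) (kappa_gt0 : 0 < kappa P).
Hypotheses (tau_n_gt0 : 0 < tau_n P) (tol_gt0 : 0 < tol P).
Hypothesis adm : admissible_metric P.

Lemma E1_ge0 s n : Vh P s -> Vhd P n -> 0 <= E1 P s n.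
Proof.
move=> Vs Vn; rewrite (E1E meshP)//; apply: mulr_ge0; first by rewrite invr_ge0.
by apply: dirichlet_ge0; exact: ltW.
Qed.

Section fixed_start.
Variables (s : E -> R) (n : E -> E).
Hypotheses (Vs : Vh P s) (Vn : Vhd P n).

Lemma inner_run_le l k nn t : (k <= l)%N -> inner_run P s n l nn t ->
  inner_run P s n k nn t.
Proof. by move=> kl [n0 H]; split => // j jk; apply: H; exact: leq_trans kl. Qed.

Lemma inner_run_Vhd l nn t : inner_run P s n l nn t -> Vhd P (nn l).
Proof.
elim: l => [[-> //]|l IH] H; have [_ /(_ l (ltnSn l))[G ->]] := H.
by apply: G1_update_Vhd G; apply: IH; exact: inner_run_le H.
Qed.

Lemma inner_run_energy l nn t : inner_run P s n l nn t ->
  E1 P s (nn l) - E1 P s n =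
  - (tau_n P * \sum_(0 <= k < l) norm_star P (t k) ^+ 2)
  - tau_n P ^+ 2 * \sum_(0 <= k < l) E1 P s (t k).
Proof.
elim: l => [|l IH] H.
  by have [-> _] := H; rewrite !big_geq// !mulr0 subrr subr0 oppr0.
have Hl := inner_run_le (leqnSn l) H.
have [_ /(_ l (ltnSn l))[G nl]] := H.
have := G1_energy meshP Vs (inner_run_Vhd Hl) G; rewrite -nl.
rewrite !big_nat_recr//=; move: (IH Hl).
move: (\sum_(0 <= k < l) norm_star P (t k) ^+ 2) (\sum_(0 <= k < l) E1 P s (t k)).
move: (norm_star P (t l) ^+ 2).
move: (E1 P s n) (E1 P s (nn l)) (E1 P s (nn l.+1)) (E1 P s (t l)).
move=> e0 e1 e2 e3 N S1 S2 h1 h2.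
by rewrite -(subrKA e1) h1 h2; ring.
Qed.

(** The direction is chosen by [xget] with default 0, so one pair of sequences serves all lengths.
    That the default never occurs is shown along the run, since solvability of (G1) requires the
    current field to be in [Vhd]. *)
Lemma inner_run_exists : exists nn t, forall l, inner_run P s n l nn t.
Proof.
pose dir m := xget 0 [set t | G1 P s m t].
pose nn k := iter k (fun (m : E -> E) x => m x + tau_n P *: dir m x) n.
exists nn, (fun k => dir (nn k)) => l.
suff H k : inner_run P s n k nn (fun k => dir (nn k)) by exact: H.
elim: k => [|k IH]; first by split.
split => // j; rewrite ltnS leq_eqVlt => /predU1P[->|]; last exact: IH.2.
split => //; rewrite /dir; case: xgetP => [t -> //|none].
have [t G] := G1_exists meshP d_gt0 kappa_gt0 tau_n_gt0 adm Vs (inner_run_Vhd IH).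
by case: (none t).
Qed.

Lemma inner_run_unique l nn t nn' t' : inner_run P s n l nn t ->
  inner_run P s n l nn' t' -> nn l = nn' l.
Proof.
elim: l => [[-> _] [-> _] //|l IH] H H'.
have Hl := inner_run_le (leqnSn l) H; have Hl' := inner_run_le (leqnSn l) H'.
have [_ /(_ l (ltnSn l))[G ->]] := H; have [_ /(_ l (ltnSn l))[G' ->]] := H'.
move: G'; rewrite -(IH Hl Hl') => G'.
by rewrite (G1_unique meshP d_gt0 kappa_gt0 tau_n_gt0 adm Vs G G').
Qed.

Lemma inner_run_stops nn t : (forall l, inner_run P s n l nn t) ->
  exists l, G2 P s (nn l) (nn l.+1).
Proof.
(* Isolated on plain reals, so that the arithmetic does not meet the energy terms. *)
have step (e0 e1 e2 x y : R) :
    y <= - (e2 - e1) -> e1 <= e0 - x * y -> e2 <= e0 - (x + 1) * y by lra.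
move=> H; apply: contrapT => never.
have decr l : E1 P s (nn l) <= E1 P s n - l%:R * tol P.
  elim: l => [|l IH]; first by have [-> _] := H 0; rewrite mul0r subr0.
  have [_ /(_ l (ltnSn l))[G nl]] := H l.+1.
  have Vl := inner_run_Vhd (H l).
  have := G1_energy meshP Vs Vl G; rewrite -nl => dE.
  have tl : tol P <= `|E1 P s (nn l.+1) - E1 P s (nn l)|.
    by rewrite leNgt; apply/negP => lt; apply: never; exists l.
  have le0 : E1 P s (nn l.+1) - E1 P s (nn l) <= 0.
    rewrite dE -opprD oppr_le0 addr_ge0// mulr_ge0 ?sqr_ge0 ?(ltW tau_n_gt0)//.
    by apply: E1_ge0 => //; have [/Kh_Vhd] := G.
  move: tl IH; rewrite ler0_norm// -natr1.
  exact: step.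
(* After more than [E1 / tol] iterations the energy would be negative. *)
have [l ltl] : exists l : nat, E1 P s n / tol P < l%:R.
  by exists (Num.bound (E1 P s n / tol P)); apply: archi_boundP;
    rewrite divr_ge0 ?E1_ge0// ltW.
have := decr l; rewrite leNgt => /negP; apply.
apply: lt_le_trans (E1_ge0 Vs (inner_run_Vhd (H l))).
by rewrite subr_lt0 -ltr_pdivrMr.
Qed.

Lemma inner_loop_exists : exists l nn t, inner_loop P s n l nn t.
Proof.
have [nn [t H]] := inner_run_exists; have [l0 G2l0] := inner_run_stops H.
have ex : exists l, `[< G2 P s (nn l) (nn l.+1) >] by exists l0; exact/asboolP.
case: (ex_minnP ex) => l /asboolP G2l lmin; exists l, nn, t; split => // k kl G2k.
by have := lmin k; rewrite leqNgt kl => /(_ (asboolT G2k)).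
Qed.

(** Runs from the same start agree, so if one loop stopped earlier, the other would meet (G2) at
    that index, against its minimality. Only the resulting field is compared, as later entries of
    the sequences are arbitrary. *)
Lemma inner_loop_unique l nn t l' nn' t' :
  inner_loop P s n l nn t -> inner_loop P s n l' nn' t' -> nn l.+1 = nn' l'.+1.
Proof.
wlog ll' : l nn t l' nn' t' / (l <= l')%N => [th|].
  move=> L L'; case/orP: (leq_total l l') => le; first exact: th L L'.
  by apply/esym; exact: th L' L.
move=> [H g _] [H' _ min'].
have [l_lt|l_ge] := ltnP l l'; last first.
  have e : l = l' by apply/eqP; rewrite eqn_leq ll'.
  by move: H'; rewrite -e => H'; exact: inner_run_unique H H'.
have Hl' : inner_run P s n l.+1 nn' t' by apply: inner_run_le H'; rewrite ltnS ltnW.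
have := min' l l_lt.
rewrite -(inner_run_unique H Hl').
by rewrite -(inner_run_unique (inner_run_le (leqnSn l) H)
  (inner_run_le (leqnSn l) Hl')).
Qed.

(** Directions lie in [VhDd], where the metric is definite, so zero norms mean zero updates. This
    serves the equality case of the energy law. *)
Lemma inner_run_stationary l nn t : inner_run P s n l nn t ->
  (forall k, (k < l)%N -> norm_star P (t k) = 0) -> nn l = n.
Proof.
elim: l => [[-> //]|l IH] H t0; have [_ /(_ l (ltnSn l))[[Kt _] ->]] := H.
have tl0 : t l = 0.
  apply: contrapT => /eqP tl0.
  have := ip_star_gt0 meshP d_gt0 adm Kt.1 tl0.
  by rewrite -(norm_star_sqr meshP (Kh_Vhd Kt)) t0// expr0n ltxx.
rewrite tl0 IH; first by apply/funext => x; rewrite scaler0 addr0.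
  exact: inner_run_le H.
by move=> k kl; apply: t0; exact: ltnW.
Qed.

End fixed_start.

End inner_iteration.

(** * From shape regularity to the theorem *)

Lemma mesh_hyp_of_shape_regular (R : realType) (d : nat) (P : problem R d)
    (family : set (mesh R d)) :
  lipschitz_polytopal_domain (Omega P) ->
  shape_regular_family (Omega P) family -> family (Th P) -> mesh_hyp P.
Proof.
move=> [[oO cO nO bO] _] [sigma famP] /famP[[_ zK _ _ cover] regular].
split => // K KT; have [c [rho [rho0 sub _]]] := regular K KT.
(* The inscribed ball is Euclidean, the basic neighbourhoods are max-norm cubes. With half-width
   [rho / sqrt(d + 1)], squared distances are at most [rho^2 d / (d + 1)], strictly below
   [rho^2]. *)
exists c; apply/nbhs_ballP; exists (rho / Num.sqrt (d%:R + 1)) => /=.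
  by rewrite divr_gt0// sqrtr_gt0 ltr_wpDl.
move=> x cx; apply: sub => /=.
rewrite /enorm -[ltRHS]ger0_norm ?(ltW rho0)// -sqrtr_sqr ltr_sqrt ?exprn_gt0//.
have /(_ ord0) cxj := cx.2.
apply: (@le_lt_trans _ _ (\sum_(j < d) (rho ^+ 2 / (d%:R + 1)))).
  rewrite /frob big_ord1; apply: ler_sum => j _.
  have := cxj j; rewrite -ball_normE /= distrC !mxE => /ltW.
  set y := x ord0 j - _; set r := rho / _ => yr.
  have -> : rho ^+ 2 / (d%:R + 1) = r ^+ 2.
    by rewrite /r expr_div_n sqr_sqrtr// addr_ge0.
  by move: yr; rewrite ler_norml => /andP[]; nra.
rewrite sumr_const card_ord -[_ *+ d]mulr_natr -mulrA.
rewrite gtr_pMr ?exprn_gt0// mulrC ltr_pdivrMr ?ltr_wpDl//.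
by rewrite mul1r ltrDl.
Qed.

Theorem proposition4p2 (R : realType) (d : nat) (P : problem R d)
    (family : set (mesh R d)) (q : 'rV[R]_d -> 'rV[R]_d) (delta0 : R)
    (s0 : 'rV[R]_d -> R) (n0 : 'rV[R]_d -> 'rV[R]_d)
    (hd : d = 2%N \/ d = 3%N)
    (hOmega : lipschitz_polytopal_domain (Omega P))
    (hkappa : 0 < kappa P)
    (hGammaD : exists2 U, open U & GammaD P = U `&` bdry (Omega P))
    (hGammaD_pos : (0 < hausdorff_measure d.-1 (GammaD P))%E)
    (hfamily : shape_regular_family (Omega P) family)
    (hTh : family (Th P))
    (hg : W1oo (gdat P)) (hq : Loo q) (hr : W1oo (rdat P))
    (hgqr : {ae @lebesgue_rV R d, forall x,
       [/\ - (d%:R - 1)^-1 < gdat P x < 1, enorm (q x) = 1 & rdat P x = gdat P x *: q x]})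
    (hdelta0 : 0 < delta0) (hgD : forall x : 'rV[R]_d, GammaD P x -> delta0 <= gdat P x)
    (hpsi : double_well_extension d (psi P))
    (hsplit : convex_splitting (psi P) (psi_c P) (psi_e P))
    (hstar : admissible_metric P)
    (htau_n : 0 < tau_n P) (htau_s : 0 < tau_s P) (htol : 0 < tol P)
    (hinput : input P s0 n0) :
  (forall i, exists! sn, iterate P s0 n0 i sn.1 sn.2) /\
  forall i s n, iterate P s0 n0 i s n ->
  [/\ (* (i) *)
      forall l nn t, inner_run P s n l nn t -> exists! t', G1 P s (nn l) t',
      (* (ii) *)
      exists l nn t, inner_run P s n l.+1 nn t /\ G2 P s (nn l) (nn l.+1),
      (* (iii) *)
      forall l nn t, inner_loop P s n l nn t -> exists! s', G3 P s (nn l.+1) s' &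
      (* (iv) *)
      forall l nn t s', inner_loop P s n l nn t -> G3 P s (nn l.+1) s' ->
      let n' := nn l.+1 in
      [/\ Eh P s' n' - Eh P s n <=
            - (tau_s P * norm_L2 P (dt P s s') ^+ 2
               + tau_n P * \sum_(0 <= k < l.+1) norm_star P (t k) ^+ 2)
            - (tau_s P ^+ 2 * E1 P (dt P s s') n'
               + tau_n P ^+ 2 * \sum_(0 <= k < l.+1) E1 P s (t k)),
          Eh P s' n' <= Eh P s n &
          Eh P s' n' = Eh P s n <-> s' = s /\ n' = n]].
Proof.
have meshP := mesh_hyp_of_shape_regular hOmega hfamily hTh.
have d0 : (0 < d)%N by case: hd => ->.
have [psi_splitE convex_c convex_e [a [b [c psi_cE]]] [derivable_e continuous_e']] :=
  hsplit.
(* The Dirichlet values of [s] are carried along so that the increments of (G3) lie in [VhD]. *)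
have invariant i s n : iterate P s0 n0 i s n -> [/\ Vh P s, Vhd P n &
    forall z : 'I_(nvert (Th P)), GammaD P (node z) -> s (node z) = gh P (node z)].
  elim=> {i s n} [|i s n l nn t s' _ [Vs Vn bc] [H _ _] [Vs' bc' _]].
    by have [Vs Vn _ bc] := hinput; split => // z /bc[].
  by split => //; exact: inner_run_Vhd Vn _ _ _ H.
have G3ex i s n l nn t : iterate P s0 n0 i s n -> inner_loop P s n l nn t ->
    exists s', G3 P s (nn l.+1) s'.
  move=> /invariant[Vs Vn bc] [H _ _]; have Vn' := inner_run_Vhd Vn H.
  exact: (G3_exists meshP hkappa htau_s Vs Vn' bc convex_c psi_cE continuous_e').
have G3un i s n l nn t s1 s2 : iterate P s0 n0 i s n -> inner_loop P s n l nn t ->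
    G3 P s (nn l.+1) s1 -> G3 P s (nn l.+1) s2 -> s1 = s2.
  move=> /invariant[Vs Vn bc] [H _ _]; have Vn' := inner_run_Vhd Vn H.
  exact: (@G3_unique _ _ _ meshP hkappa htau_s _ _ _ _ _ Vs Vn' bc convex_c psi_cE).
split.
  elim=> [|i [[s n] [/= it uniq_it]]].
    exists (s0, n0); split; first exact: iterate0.
    by move=> [s n] /= it; inversion it.
  have [Vs Vn bc] := invariant _ _ _ it.
  have [l [nn [t L]]] := inner_loop_exists meshP d0 hkappa htau_n htol hstar Vs Vn.
  have [s' G] := G3ex _ _ _ _ _ _ it L.
  exists (s', nn l.+1); split; first exact: iterateS it L G.
  move=> [s2 n2] /= it2; inversion it2 as [|? sp np lp nnp tp ? itp Lp Gp]; subst.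
  (* Uniqueness at level [i] identifies the predecessor found by inversion; the inner loop and (G3)
     then leave one choice each. *)
  have [? ?] : (s, n) = (sp, np) by exact: (uniq_it (sp, np)).
  subst.
  have e := inner_loop_unique meshP d0 hkappa htau_n hstar Vs L Lp.
  by rewrite -e in Gp *; rewrite (G3un _ _ _ _ _ _ _ _ it L G Gp).
move=> i s n it; have [Vs Vn bc] := invariant _ _ _ it; split.
- move=> l nn t H; have Vl := inner_run_Vhd Vn H.
  have [t' G] := G1_exists meshP d0 hkappa htau_n hstar Vs Vl.
  by exists t'; split => // t''; exact: G1_unique.
- have [l [nn [t [H G _]]]] :=
    inner_loop_exists meshP d0 hkappa htau_n htol hstar Vs Vn.
  by exists l, nn, t.
- move=> l nn t L; have [s' G] := G3ex _ _ _ _ _ _ it L.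
  by exists s'; split => // s''; exact: G3un it L G.
move=> l nn t s' [H _ _] G n'; have Vn' : Vhd P n' := inner_run_Vhd Vn H.
have eE := G3_energy meshP htau_s Vs Vn' bc psi_splitE convex_c convex_e psi_cE
  derivable_e continuous_e' G.
have eN : E1 P s n' - E1 P s n = _ := inner_run_energy meshP Vs Vn H.
(* Passing through the intermediate state [(s, n')] separates the two directions; [E2] cancels in
   the second difference because it does not depend on [n]. *)
have eEh : Eh P s' n' - Eh P s n =
    (Eh P s' n' - Eh P s n') + (E1 P s n' - E1 P s n).
  rewrite /Eh; move: (E1 P s' n') (E1 P s n') (E1 P s n) (E2 P s') (E2 P s).
  by move=> ? ? ? ? ?; ring.
have dec : Eh P s' n' - Eh P s n <=
    - (tau_s P * norm_L2 P (dt P s s') ^+ 2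
       + tau_n P * \sum_(0 <= k < l.+1) norm_star P (t k) ^+ 2)
    - (tau_s P ^+ 2 * E1 P (dt P s s') n'
       + tau_n P ^+ 2 * \sum_(0 <= k < l.+1) E1 P s (t k)).
  rewrite eEh eN; apply: le_trans (lerD eE (lexx _)) _.
  by rewrite !opprD [leRHS]addrACA.
have Vdt : Vh P (dt P s s').
  by rewrite dtE; apply: (subspaceZ _ (Vh_subspace P)); have [] := G3_increment Vs bc G.
have tK k : (k < l.+1)%N -> G1 P s (nn k) (t k) by move=> kl; have [] := H.2 k kl.
have Vt k : (k < l.+1)%N -> Vhd P (t k) by move=> /tK[/Kh_Vhd].
have A0 : 0 <= tau_s P * norm_L2 P (dt P s s') ^+ 2.
  by rewrite mulr_ge0 ?sqr_ge0 ?(ltW htau_s).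
have B0 : 0 <= tau_n P * \sum_(0 <= k < l.+1) norm_star P (t k) ^+ 2.
  by rewrite mulr_ge0 ?(ltW htau_n)// sumr_ge0// => k _; rewrite sqr_ge0.
have CD0 : 0 <= tau_s P ^+ 2 * E1 P (dt P s s') n'
    + tau_n P ^+ 2 * \sum_(0 <= k < l.+1) E1 P s (t k).
  apply: addr_ge0; apply: mulr_ge0; rewrite ?sqr_ge0//.
    exact: (E1_ge0 meshP hkappa Vdt Vn').
  rewrite big_mkord; apply: sumr_ge0 => k _.
  exact: (E1_ge0 meshP hkappa Vs (Vt k (ltn_ord k))).
split => //.
  rewrite -subr_le0; apply: le_trans dec _.
  by rewrite -opprD oppr_le0 addr_ge0// addr_ge0.
split=> [eqE|[-> ->//]].
(* Equality forces the sum of both nonnegative brackets to be at most 0. The first bracket then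
   vanishes, and definiteness of its norms means that neither [s] nor [n] has moved. *)
move: dec; rewrite eqE subrr -opprD oppr_ge0 => sum_le0.
have : (tau_s P * norm_L2 P (dt P s s') ^+ 2
       + tau_n P * \sum_(0 <= k < l.+1) norm_star P (t k) ^+ 2) <= 0.
  by apply: le_trans sum_le0; rewrite lerDl.
rewrite le_eqVlt ltNge addr_ge0// orbF paddr_eq0// => /andP[].
rewrite !mulf_eq0 (gt_eqF htau_s) (gt_eqF htau_n) orbb /= => /eqP dt0.
rewrite big_mkord psumr_eq0; last by move=> k _; exact: sqr_ge0.
move=> /allP t0; split.
  have : dt P s s' = 0.
    apply: contrapT => /eqP /(ips_gt0 meshP Vdt).
    by rewrite -norm_L2_sqr dt0 expr0n ltxx.
  move=> dts0; apply/eqP; rewrite -subr_eq0; apply/eqP.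
  rewrite -[s' - s](@scalerK _ _ (tau_s P)^-1); last by rewrite invr_eq0 gt_eqF.
  by rewrite -dtE dts0 scaler0.
apply: (inner_run_stationary meshP d0 hstar H) => k kl.
have /(_ (Ordinal kl)) := t0; rewrite mem_index_enum sqrf_eq0 => /(_ isT) /eqP.
exact.
Qed.
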